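(* Let $\gamma,\beta,\rho,\delta\in\mathbb{C}$ and $p,q>0$ such that $\mathrm{Re}(\gamma)>0$, $\mathrm{Re}(\beta)>0$, $\mathrm{Re}(\rho)>0$, $\mathrm{Re}(\delta)>0$ and $\mathrm{Re}(\gamma)+p\ge q$, let $f,g:[a,b]\to\mathbb{R}$ be differentiable functions and $0<\alpha<1$. Then $$\int_a^b f(x)\Big({}_{i}^{\rho}\mathcal{V}_{\gamma,\beta,\alpha}^{\delta,p,q}g(x)\Big)\,d_\omega x=f(x)g(x)\Big|_a^b-\int_a^b g(x)\Big({}_{i}^{\rho}\mathcal{V}_{\gamma,\beta,\alpha}^{\delta,p,q}f(x)\Big)\,d_\omega x,$$ with $d_\omega x=\dfrac{\Gamma(\gamma+\beta)(\delta)_p}{\Gamma(\beta)(\rho)_q}\dfrac{dx}{x^{1-\alpha}}$.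
   Context: Here $(\rho)_{s}=\Gamma(\rho+s)/\Gamma(\rho)$ and $(\delta)_{s}=\Gamma(\delta+s)/\Gamma(\delta)$ are (generalized) Pochhammer symbols. The truncated function, with the index $i$ being the upper limit of summation, is $${}_{i}H_{\gamma,\beta,p}^{\rho,\delta,q}(z):=\Gamma(\beta)\sum_{k=0}^{i}\frac{(\rho)_{qk}}{(\delta)_{pk}}\frac{z^k}{\Gamma(\gamma k+\beta)}.$$ The truncated $\mathcal{V}$-fractional derivative of order $\alpha$, $0<\alpha<1$, of a function $h$ is defined, for $x>0$, by $${}_{i}^{\rho}\mathcal{V}_{\gamma,\beta,\alpha}^{\delta,p,q}h(x):=\lim_{\epsilon\to 0}\frac{h\big(x\,{}_{i}H_{\gamma,\beta,p}^{\rho,\delta,q}(\epsilon x^{-\alpha})\big)-h(x)}{\epsilon}.$$ Integration against $d_\omega x$ is the $\mathcal{V}$-fractional integral of order $\alpha$, ${}_{a}^{\rho}\mathcal{I}_{\gamma,\beta,\alpha}^{\delta,p,q}h(t)=\frac{\Gamma(\gamma+\beta)(\delta)_p}{\Gamma(\beta)(\rho)_q}\int_a^t\frac{h(x)}{x^{1-\alpha}}dx$, which is defined for $a\ge 0$ and $t\ge a$.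
   Formalization: Adds i ≥ 1 (for i = 0 the derivative is 0 and the identity fails) and assumes both displayed integrals exist as Lebesgue integrals (mere differentiability of f, g does not ensure it); with complex parameters ε ranges over values making the argument of h real and in [a,b]. *)

(* Defs.v *)
From HB Require Import structures.
From mathcomp Require Import all_boot all_order all_algebra.
From mathcomp Require Import all_classical all_reals all_analysis.
From mathcomp Require Import complex.

Set Implicit Arguments.
Unset Strict Implicit.
Unset Printing Implicit Defensive.

Import Order.TTheory GRing.Theory Num.Theory.
Import numFieldNormedType.Exports.

Local Open Scope classical_set_scope.
Local Open Scope ring_scope.
Local Open Scope complex_scope.

(* The principal value of t^z = exp (z ln t), meaningful for t > 0. *)
Definition cpow (R : realType) (t : R) (z : R[i]) : R[i] :=
  (t `^ complex.Re z)%:C *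
  (cos (complex.Im z * ln t) +i* sin (complex.Im z * ln t)).

Definition cintegrable (R : realType) (D : set R) (F : R -> R[i]) : Prop :=
  (@lebesgue_measure R).-integrable D (fun x => (complex.Re (F x))%:E) /\
  (@lebesgue_measure R).-integrable D (fun x => (complex.Im (F x))%:E).

Definition cintegral (R : realType) (D : set R) (F : R -> R[i]) : R[i] :=
  (\int[@lebesgue_measure R]_(x in D) complex.Re (F x)) +i*
  (\int[@lebesgue_measure R]_(x in D) complex.Im (F x)).

(* Euler's integral; it is Gamma(z) for Re z > 0, and every argument at which
   it is used below has positive real part as soon as the parameters do. *)
Definition Gamma (R : realType) (z : R[i]) : R[i] :=
  cintegral `]0, +oo[%classic (fun t => cpow t (z - 1) * (expR (- t))%:C).

Definition pochhammer (R : realType) (z : R[i]) (s : R) : R[i] :=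
  Gamma (z + s%:C) / Gamma z.

Definition truncH (R : realType) (i : nat) (gamma beta rho delta : R[i])
    (p q : R) (z : R[i]) : R[i] :=
  Gamma beta * \sum_(0 <= k < i.+1)
    pochhammer rho (q * k%:R) / pochhammer delta (p * k%:R) *
    (z ^+ k / Gamma (gamma * k%:R + beta)).

(* The points e <> 0 at which the difference quotient of h : D -> R in
   [Vderivative] makes sense: x H(e x^-alpha) must be (a real number) in D.
   With complex parameters this forces e to be complex in general.  When the
   coefficients of H are real, the small e with x H(e x^-alpha) real are exactly
   the small real e: H commutes with conjugation, and it is injective near 0
   because H'(0) <> 0 (for 1 <= i).  So, with such coefficients, the limit
   below is the limit over real e. *)
Definition Vdomain (R : realType) (i : nat) (gamma beta rho delta : R[i])
    (p q alpha : R) (D : set R) (x : R) : set R[i] :=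
  [set e | e != 0 /\ exists2 y, D y &
    x%:C * truncH i gamma beta rho delta p q (e * (x `^ (- alpha))%:C) = y%:C].

(* The truncated V-fractional derivative at x > 0 of a function h with domain
   D; the values of h outside D play no role.  On [Vdomain] the argument
   x H(e x^-alpha) is real, so taking its real part does not change it. *)
Definition Vderivative (R : realType) (i : nat) (gamma beta rho delta : R[i])
    (p q alpha : R) (D : set R) (h : R -> R) (x : R) : R[i] :=
  let H := truncH i gamma beta rho delta p q in
  lim (((h (complex.Re (x%:C * H (e * (x `^ (- alpha))%:C))) - h x)%:C / e
         : R[i]^o)
    @[e --> within (Vdomain i gamma beta rho delta p q alpha D x)
              (nbhs (0 : R[i]^o))]).

Definition Vconst (R : realType) (gamma beta rho delta : R[i])
    (p q : R) : R[i] :=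
  (Gamma (gamma + beta) * pochhammer delta p) /
  (Gamma beta * pochhammer rho q).

Definition Vintegrable (R : realType) (alpha a t : R) (h : R -> R[i]) : Prop :=
  cintegrable `[a, t]%classic (fun x => h x / (x `^ (1 - alpha))%:C).

(* The V-fractional integral of h, i.e. the integral of h over [a, t] against
   d_omega x. *)
Definition Vintegral (R : realType) (gamma beta rho delta : R[i])
    (p q alpha a t : R) (h : R -> R[i]) : R[i] :=
  Vconst gamma beta rho delta p q *
  cintegral `[a, t]%classic (fun x => h x / (x `^ (1 - alpha))%:C).

(* Differentiability of h : [a, b] -> R on [a, b], one-sided at a and b. *)
Definition differentiable_on_segment (R : realType) (a b : R) (h : R -> R) :
    Prop :=
  forall x, x \in `[a, b] ->
    cvg (((h y - h x) / (y - x) : R) @[y --> within `[a, b]%classic x^']).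

(* Main.v *)
(* The coefficients of [truncH] at [z^0] and [z^1] are [1] and the inverse of
   [Vconst], because Gamma has no zero in the right half-plane.  Hence the
   V-derivative of [h] at an interior point [x] is [h'(x) x^(1 - alpha) / Vconst]:
   the points [e] of [Vdomain] do accumulate at [0], since the polynomial
   [x H(e x^-alpha) - y] has a small root [e] when [y] is close to [x].  All
   constants cancel, and the theorem becomes ordinary integration by parts for
   functions that are differentiable everywhere with merely integrable [f g']
   and [g f']; this needs the fundamental theorem of calculus for an everywhere
   differentiable function with Lebesgue integrable derivative.

   Gamma(x + iy) <> 0: by the functional equation one may take [x] large; then
   the real part of [x^(-iy) Gamma(x + iy)] is the integral of
   [t^(x-1) e^-t cos (y ln (t/x))], which is positive because
   [(ln (t/x))^2 <= 4 (t/x - 2 + x/t)] and the integral of the right-hand side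
   against [t^(x-1) e^-t] is [4 Gamma(x) / (x - 1)]. *)
Require Import Defs.
From HB Require Import structures.
From mathcomp Require Import all_boot all_order all_algebra.
From mathcomp Require Import all_classical all_reals all_analysis.
From mathcomp Require Import measurable_realfun.
From mathcomp Require Import complex.
From mathcomp Require Import ring lra.

Set Implicit Arguments.
Unset Strict Implicit.
Unset Printing Implicit Defensive.

Import Order.TTheory GRing.Theory Num.Theory.
Import numFieldNormedType.Exports.

Local Open Scope classical_set_scope.
Local Open Scope ring_scope.
Local Open Scope complex_scope.

(** * The fundamental theorem of calculus for an integrable derivative *)

(** Take the supremum [s] of the points up to which [P] holds throughout: [stepl] gives [P s], and
    if [s < d] then [stepr] would carry [P] beyond [s]. *)
Lemma real_induction (R : realType) (P : R -> Prop) (c d : R) :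
  c <= d -> P c ->
  (forall x, c <= x < d -> P x -> \forall y \near x^'+, P y) ->
  (forall x, c < x <= d -> (forall y, c <= y < x -> P y) -> P x) ->
  P d.
Proof.
move=> cd Pc stepr stepl.
pose S := [set x | c <= x <= d /\ forall y, c <= y <= x -> P y].
have Sc : S c.
  split; first by rewrite lexx cd.
  by move=> y /andP[cy yc]; rewrite (_ : y = c)//; apply/eqP; rewrite eq_le yc.
have hS : has_sup S by split; [exists c|exists d => x [/andP[]]].
set s := sup S.
have cs : c <= s by apply: sup_upper_bound.
have sd : s <= d by apply: ge_sup; [exists c|move=> x [/andP[]]].
have Pbelow y : c <= y < s -> P y.
  move=> /andP[cy ys].
  have s_y : 0 < s - y by rewrite subr_gt0.
  have [x [_ Px] yx] := sup_adherent s_y hS.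
  apply: Px; rewrite cy/= ltW//.
  by move: yx; rewrite -/s opprB addrC subrK.
have Ps : P s.
  move: cs; rewrite le_eqVlt => /predU1P[<-//|cs].
  by apply: stepl => //; rewrite cs.
have Ss : forall y, c <= y <= s -> P y.
  move=> y /andP[cy]; rewrite le_eqVlt => /predU1P[->//|ys].
  by apply: Pbelow; rewrite cy.
move: sd; rewrite le_eqVlt => /predU1P[<-//|sd].
have [|e /= e0 He] := stepr s _ Ps; first by rewrite cs.
pose z := Num.min d (s + e / 2).
have e20 : 0 < e / 2 by rewrite divr_gt0.
have sz : s < z by rewrite lt_min sd ltrDl.
suff /(sup_upper_bound hS) : S z by rewrite -/s leNgt sz.
split; first by rewrite ge_min lexx (le_trans cs (ltW sz)).
move=> y /andP[cy yz]; have [ys|sy] := leP y s; first by apply: Ss; rewrite cy.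
apply: He => //=; rewrite distrC gtr0_norm ?subr_gt0// ltrBlDl.
rewrite (le_lt_trans yz)// gt_min; apply/orP; right.
by rewrite ltrD2l ltr_pdivrMr// mulr_natr mulr2n ltrDl.
Qed.

(* A weak form of the Vitali-Caratheodory theorem: [u] is a sum of multiples of
   indicators of open sets slightly larger than the level sets of [w]. *)
Lemma open_majorant (R : realType) (a b : R) (w : R -> R) (eps : R) :
  let mu := @lebesgue_measure R in
  a < b -> 0 < eps ->
  measurable_fun `]a, b[ w -> (forall x, x \in `]a, b[ -> 0 <= w x) ->
  exists u : R -> \bar R,
    [/\ measurable_fun `]a, b[ u, (forall x, 0 <= u x)%E,
      (\int[mu]_(x in `]a, b[) u x <= \int[mu]_(x in `]a, b[) (w x)%:E + eps%:E)%E
    & forall x, x \in `]a, b[ -> \forall y \near x, ((w x)%:E <= u y)%E].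
Proof.
move=> mu ab eps0 mw w0.
have ba0 : 0 < b - a by rewrite subr_gt0.
(* [eta] is the mesh of the level sets [E n] of [w]: rounding [w] up by at most [eta] on an interval
   of length [b - a] costs [eps / 2]. *)
have [eta eta0 etaE] : exists2 eta, 0 < eta & eta * (b - a) = eps / 2.
  by exists (eps / 2 / (b - a)); rewrite ?divr_gt0// divfK// gt_eqF.
pose D : set R := `]a, b[%classic.
have mD : measurable D by exact: measurable_itv.
have wq0 x : D x -> 0 <= w x / eta by move=> Dx; rewrite divr_ge0 ?w0// ltW.
pose E n := D `&` [set x | Num.trunc (w x / eta) = n].
have mE n : measurable (E n).
  rewrite (_ : E n = D `&` w @^-1` `[n%:R * eta, n.+1%:R * eta[%classic).
    exact: mw.
  apply/seteqP; split => x [Dx] /=.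
    move=> /eqP; rewrite truncn_eq ?wq0//.
    by rewrite ?in_itv/= ler_pdivlMr// ltr_pdivrMr// => ?; split.
  rewrite /= ?in_itv/= => H; split => //=; apply/eqP.
  by rewrite truncn_eq ?wq0// ler_pdivlMr// ltr_pdivrMr.
have muD : mu D = (b - a)%:E by rewrite /mu lebesgue_measure_itv/= lte_fin ab.
have EU : \bigcup_n E n = D.
  apply/seteqP; split; first by move=> x [n _ []].
  by move=> x Dx; exists (Num.trunc (w x / eta)).
have muE n : (mu (E n) < +oo)%E.
  apply: (@le_lt_trans _ _ (mu D)); last by rewrite muD ltry.
  by apply: le_measure; rewrite ?inE; [exact: mE|exact: mD|move=> x []].
(* The excess measure allowed for [U_ n]: weighted by the level [n.+1%:R * eta] it costs
   [eps / 2 / 2 ^ n.+1], and these costs add up to [eps / 2]. *)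
pose del n := eps / 2 / (2 ^ n.+1)%:R / (n.+1%:R * eta).
have del0 n : 0 < del n by rewrite !divr_gt0// mulr_gt0.
have /choice[U_ HO] : forall n, exists V : set R,
    [/\ open V, E n `<=` V & (mu (V `\` E n) < (del n)%:E)%E].
  by move=> n; exact: lebesgue_regularity_outer.
have mO n : measurable (U_ n) by apply: open_measurable; have [] := HO n.
pose h n (x : R) : \bar R := ((n.+1%:R * eta) * \1_(U_ n) x)%:E.
have h0 n x : (0 <= h n x)%E by rewrite lee_fin mulr_ge0// mulr_ge0// ltW.
have mh n (A : set R) : measurable_fun A (h n).
  by apply/measurable_EFinP; apply: measurable_funM.
exists (fun x => \sum_(0 <= n <oo) h n x)%E; split.
- by apply: ge0_emeasurable_sum.
- by move=> x; apply: nneseries_ge0.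
- rewrite integral_nneseries//.
  apply: (@le_trans _ _ (\sum_(0 <= n <oo)
      (\int[mu]_(x in E n) ((w x)%:E + eta%:E) + (eps / 2 / (2 ^ n.+1)%:R)%:E))%E).
    apply: lee_nneseries => [n _ _|n _]; first exact: integral_ge0.
    under eq_integral do rewrite /h EFinM.
    rewrite ge0_integralZl//; last 2 first.
    - by apply/measurable_EFinP; apply: measurable_indic; exact: mO.
    - by rewrite lee_fin mulr_ge0// ltW.
    rewrite integral_indic; [|exact: mD|exact: mO].
    apply: (@le_trans _ _ ((n.+1%:R * eta)%:E * (mu (E n) + (del n)%:E))%E).
      rewrite lee_pmul2l//; last by rewrite lte_fin mulr_gt0.
      apply: (@le_trans _ _ (mu (U_ n))).
        apply: le_measure; rewrite ?inE; [|exact: mO|by move=> x []].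
        by apply: measurableI; [exact: mO|exact: mD].
      have [oO EO muO] := HO n.
      have -> : mu (U_ n) = (mu (E n) + mu (U_ n `\` E n))%E.
        rewrite -measureU; first by rewrite setDUK.
        - exact: mE.
        - by apply: measurableD; [exact: mO|exact: mE].
        - by apply/seteqP; split => // x [? []].
      by rewrite leeD2l// ltW.
    rewrite ge0_muleDr//; last by rewrite lee_fin ltW.
    apply: leeD; last first.
      rewrite -EFinM lee_fin /del mulrC divfK// mulf_neq0// ?gt_eqF//.
    rewrite -integral_cst; last exact: mE.
    apply: ge0_le_integral.
    - exact: mE.
    - by move=> x _ /=; rewrite lee_fin mulr_ge0// ltW.
    - exact: measurable_cst.
    - apply: emeasurable_funD; last exact: measurable_cst.
      by apply/measurable_EFinP; apply: measurable_funS mw => // x [].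
    - move=> x [Dx /= /eqP]; rewrite truncn_eq ?wq0//.
      rewrite ler_pdivlMr// => /andP[H _]; rewrite -EFinD lee_fin.
      by rewrite -addn1 natrD mulrDl mul1r lerD2r.
  apply: (le_trans (epsilon_trick _ _ _)).
  - move=> n; apply: integral_ge0 => x [Dx _].
    by rewrite -EFinD lee_fin addr_ge0 ?w0// ltW.
  - by rewrite divr_ge0// ltW.
  have mwE : measurable_fun D (EFin \o w) by exact/measurable_EFinP.
  rewrite -ge0_integral_bigcup; first last.
  - apply/trivIsetP => i j _ _ ij; apply/seteqP; split => // x [[_ /= Hi] [_ /= Hj]].
    by move: ij; rewrite -Hi -Hj eqxx.
  - by rewrite EU => x Dx; rewrite -EFinD lee_fin addr_ge0 ?w0// ltW.
  - rewrite EU; apply: emeasurable_funD; first exact: mwE.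
    exact: measurable_cst.
  - exact: mE.
  rewrite EU ge0_integralD; first last.
  - exact: measurable_cst.
  - by move=> x _ /=; rewrite lee_fin ltW.
  - exact: mwE.
  - by move=> x Dx /=; rewrite lee_fin w0.
  - exact: mD.
  rewrite integral_cst; last exact: mD.
  rewrite [X in (_ * X)%E](muD) -EFinM etaE.
  by rewrite -addeA -EFinD -splitr.
- by move=> n; exact: mh.
- move=> x Dx; pose n := Num.trunc (w x / eta).
  have [oO EO _] := HO n.
  have Ox : U_ n x by apply: EO.
  have wn : w x <= n.+1%:R * eta.
    have := @truncn_itv _ (w x / eta).
    rewrite wq0// => /(_ isT)/andP[_].
    by rewrite ltr_pdivrMr// => /ltW.
  near=> y.
  have Oy : U_ n y by near: y; exact: open_nbhs_nbhs.
  apply: (@le_trans _ _ (h n y)).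
    by rewrite /h indicE mem_set// mulr1 lee_fin.
  rewrite (@nneseriesD1 _ _ n)//.
  by rewrite leeDl//; apply: nneseries_ge0.
Unshelve. all: by end_near.
Qed.

Lemma derivable_right_slope (R : realType) (F : R -> R) (x k : R) :
  derivable F x 1 -> derive1 F x < k ->
  \forall y \near x^'+, F y - F x <= k * (y - x).
Proof.
rewrite derive1E => /cvg_dnbhs_at_right dF Fk.
have [r /= r0 Hr] := @cvgr_le _ _ _ _ _ _ dF _ Fk.
exists r => //= y /= xyr xy.
have := Hr (y - x); rewrite /= sub0r normrN distrC => /(_ xyr).
rewrite subr_gt0 => /(_ xy).
rewrite scaler1 subrK -[_ *: _]/(_ * _) mulrC ler_pdivrMr ?subr_gt0//.
Qed.

(* Real induction on [F y - F c - e' (y - c) <= int_c^y u], where [u >= w x] near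
   every point [x]. *)
Lemma increment_le_integral_inner (R : realType) (a b c d : R) (F w : R -> R) :
  let mu := @lebesgue_measure R in
  a < c -> c <= d -> d < b ->
  measurable_fun `]a, b[ w -> (forall x, x \in `]a, b[ -> 0 <= w x) ->
  (forall x, x \in `]a, b[ -> derivable F x 1 /\ derive1 F x <= w x) ->
  ((F d - F c)%:E <= \int[mu]_(x in `]a, b[) (w x)%:E)%E.
Proof.
move=> mu ac cd db mw w0 dF.
apply/lee_addgt0Pr => e e0.
have ab : a < b by rewrite (lt_trans ac)// (le_lt_trans cd).
have K0 : 0 < 1 + (d - c) by rewrite ltr_wpDr// subr_ge0.
(* [e'] is spent once in the majorant [u] and once per unit length in the slope, hence the
   denominator. *)
pose e' := e / (1 + (d - c)).
have e'0 : 0 < e' by rewrite divr_gt0.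
have [u [mu_ u0 iu wu]] := open_majorant ab e'0 mw w0.
pose J (x : R) := (\int[mu]_(y in `]c, x]) u y)%E.
have msub (x y : R) : c <= x -> y < b -> measurable_fun `]x, y] u.
  move=> cx yb; apply: measurable_funS mu_; first exact: measurable_itv.
  move=> z /=; rewrite !in_itv/= => /andP[xz zy].
  by rewrite (lt_trans ac (le_lt_trans cx xz)) (le_lt_trans zy).
have J0 x : (0 <= J x)%E by apply: integral_ge0.
pose P x := ((F x - F c - e' * (x - c))%:E <= J x)%E.
suff Pd : P d.
  have : (J d <= \int[mu]_(x in `]a, b[) (w x)%:E + e'%:E)%E.
    apply: le_trans iu; apply: ge0_subset_integral.
    - exact: measurable_itv.
    - exact: measurable_itv.
    - exact: mu_.
    - by move=> x _; exact: u0.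
    - move=> z /=; rewrite !in_itv/= => /andP[cz zd].
      by rewrite (lt_trans ac cz) (le_lt_trans zd).
  move=> /(le_trans Pd) {Pd}.
  have -> : e = e' + e' * (d - c) by rewrite -{1}(mulr1 e') -mulrDr divfK ?gt_eqF.
  rewrite EFinB leeBlDr// => H.
  by rewrite [X in (_ <= _ + X)%E]EFinD addeA.
apply: (@real_induction _ P c d) => //.
- by rewrite /P !subrr mulr0 subr0; exact: J0.
- move=> x /andP[cx xd] Px.
  have Dx : x \in `]a, b[ by rewrite in_itv/= (lt_le_trans ac cx) (lt_trans xd).
  have [dFx Fwx] := dF _ Dx.
  have wub : \forall y \near x^'+, forall z, x < z <= y -> ((w x)%:E <= u z)%E.
    have [r /= r0 Hr] := wu _ Dx.
    exists r => //= y /= xyr xy z /andP[xz zy]; apply: Hr => /=.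
    rewrite ltr0_norm ?subr_lt0// opprB; move: xyr.
    by rewrite ltr0_norm ?subr_lt0// opprB; apply: le_lt_trans; rewrite lerD2r.
  (* The slack [e'] makes the bound on the derivative strict, so that it passes to the difference
     quotients just to the right of [x]. *)
  have Fe : derive1 F x < w x + e' by rewrite (le_lt_trans Fwx)// ltrDl.
  have slope := derivable_right_slope dFx Fe.
  near=> y.
  have xy : x < y by near: y; exact: nbhs_right_gt.
  have yb : y < b by near: y; apply: nbhs_right_lt; exact: lt_trans xd db.
  have Fy : F y - F x <= (w x + e') * (y - x) by near: y.
  have wuy : forall z, x < z <= y -> ((w x)%:E <= u z)%E by near: y.
  have JE : (J y = J x + \int[mu]_(z in `]x, y]) u z)%E.
    have E : `]c, y]%classic = `]c, x]%classic `|` `]x, y]%classic :> set R.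
      by apply: itv_bndbnd_setU; rewrite bnd_simp// ltW.
    rewrite /J E ge0_integral_setU; [by []|exact: measurable_itv| |..].
    - exact: measurable_itv.
    - by rewrite -E; exact: msub.
    - by move=> z _; exact: u0.
    - apply/disj_setPS => z /= []; rewrite !in_itv/= => /andP[_ zx] /andP[xz _].
      by move: (lt_le_trans xz zx); rewrite ltxx.
  have Iw : ((w x * (y - x))%:E <= \int[mu]_(z in `]x, y]) u z)%E.
    apply: (@le_trans _ _ (\int[mu]_(z in `]x, y]) cst (w x)%:E z)%E).
      rewrite integral_cst; last exact: measurable_itv.
      have muxy : mu `]x, y]%classic = (y - x)%:E.
        by rewrite /mu lebesgue_measure_itv/= lte_fin xy.
      by rewrite [X in (_ * X)%E](muxy).
    apply: ge0_le_integral.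
    - exact: measurable_itv.
    - by move=> z _ /=; rewrite lee_fin w0.
    - exact: measurable_cst.
    - exact: msub.
    - by move=> z /=; rewrite in_itv/=; exact: wuy.
  rewrite /P JE.
  have -> : F y - F c - e' * (y - c) =
     (F x - F c - e' * (x - c)) + (F y - F x - e' * (y - x)) by ring.
  rewrite EFinD; apply: leeD => //.
  apply: le_trans Iw; rewrite lee_fin; move: Fy; rewrite mulrDl; lra.
- move=> x /andP[cx xd] Px; rewrite /P.
  have Dx : x \in `]a, b[ by rewrite in_itv/= (lt_trans ac cx) (le_lt_trans xd).
  have [dFx Fwx] := dF _ Dx.
  (* [J] is nondecreasing, so [J x] bounds the left-hand sides for all [y < x], and continuity of
     [F] at [x] then gives [P x]. *)
  have : (forall y, c <= y < x -> ((F y - F c - e' * (y - c))%:E <= J x)%E).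
    move=> y ycx; apply: (le_trans (Px _ ycx)).
    apply: ge0_subset_integral.
    - exact: measurable_itv.
    - exact: measurable_itv.
    - by apply: msub => //; exact: le_lt_trans db.
    - by move=> z _; exact: u0.
    - move: ycx => /andP[_ yx] z /=; rewrite !in_itv/= => /andP[-> zy].
      by rewrite (le_trans zy)// ltW.
  move: (J0 x); case: (J x) => [j| |]//; last first.
    by move=> _ _; rewrite leey.
  move=> _ H; rewrite lee_fin.
  have Fc : F y - F c - e' * (y - c) @[y --> x^'-] --> F x - F c - e' * (x - c).
    apply: cvg_at_left_filter; apply: cvgB; last first.
      apply: cvgM; first exact: cvg_cst.
      by apply: cvgB; [exact: cvg_id|exact: cvg_cst].
    apply: cvgB; last exact: cvg_cst.
    by apply: differentiable_continuous; apply/derivable1_diffP.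
  apply: (cvgr_to_le Fc); near=> y.
  rewrite -lee_fin H//; apply/andP; split; last by near: y; exact: nbhs_left_lt.
  by apply: ltW; near: y; exact: nbhs_left_gt.
Unshelve. all: by end_near.
Qed.

(** The inner estimate is uniform in [c] and [d]: let [d] tend to [b] and [c] to [a], using
    one-sided continuity at the ends. An infinite integral leaves nothing to prove. *)
Lemma increment_le_integral (R : realType) (a b : R) (F w : R -> R) :
  let mu := @lebesgue_measure R in
  a < b -> derivable_oo_LRcontinuous F a b ->
  measurable_fun `]a, b[ w -> (forall x, x \in `]a, b[ -> 0 <= w x) ->
  (forall x, x \in `]a, b[ -> derive1 F x <= w x) ->
  ((F b - F a)%:E <= \int[mu]_(x in `]a, b[) (w x)%:E)%E.
Proof.
move=> mu ab [dF Fa Fb] mw w0 Fw.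
have {}Fw x : x \in `]a, b[ -> derivable F x 1 /\ derive1 F x <= w x.
  by move=> xab; split; [exact: dF|exact: Fw].
have {dF} H c d ac cd db := increment_le_integral_inner (c := c) (d := d) ac cd db mw w0 Fw.
have : (0 <= \int[mu]_(x in `]a, b[) (w x)%:E)%E.
  by apply: integral_ge0 => x /= xab; rewrite lee_fin; exact: w0.
move: H; rewrite -/mu; case: (\int[mu]_(x in `]a, b[) (w x)%:E)%E => [I| |]//; last first.
  by move=> _ _; rewrite leey.
move=> H _; rewrite lee_fin lerBlDr addrC -lerBlDr.
have Hc c : a < c < b -> F b - I <= F c.
  move=> /andP[ac cb]; rewrite lerBlDr addrC -lerBlDr.
  have FFb : F y - F c @[y --> b^'-] --> F b - F c by apply: cvgB => //; exact: cvg_cst.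
  apply: (cvgr_to_le FFb); near=> y.
  have cy : c < y by near: y; exact: nbhs_left_gt.
  have yb : y < b by near: y; exact: nbhs_left_lt.
  by rewrite -lee_fin; apply: H => //; exact: ltW.
apply: (cvgr_to_ge Fa); near=> y; apply: Hc.
by apply/andP; split; near: y; [exact: nbhs_right_gt|exact: nbhs_right_lt].
Unshelve. all: by end_near.
Qed.

(** To allow a signed [w], truncate it below at [- n], then add [n] to the truncation and [n x] to
    [F]; both sides grow by the same [n (b - a)]. Dominated convergence lets [n] tend to
    infinity. *)
Lemma increment_le_Rintegral (R : realType) (a b : R) (F w : R -> R) :
  let mu := @lebesgue_measure R in
  a < b -> derivable_oo_LRcontinuous F a b ->
  mu.-integrable `]a, b[ (EFin \o w) ->
  (forall x, x \in `]a, b[ -> derive1 F x <= w x) ->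
  F b - F a <= \int[mu]_(x in `]a, b[) w x.
Proof.
move=> mu ab [dF Fa Fb] iw Fw.
have mD : measurable (`]a, b[%classic : set R) by exact: measurable_itv.
have mw : measurable_fun `]a, b[ w.
  by apply/measurable_EFinP; exact: measurable_int iw.
pose v (n : nat) x := Num.max (w x) (- n%:R).
have mv n : measurable_fun `]a, b[ (v n).
  by apply: measurable_maxr => //; exact: measurable_cst.
have vw n x : `|v n x| <= `|w x|.
  rewrite /v; case: (leP (w x) (- n%:R)) => [wn|//].
  have n0 : 0 <= n%:R :> R by exact: ler0n.
  have w0 : w x <= 0 by apply: le_trans wn _; rewrite oppr_le0.
  by rewrite normrN (ger0_norm n0) (ler0_norm w0) lerNr.
have iv n : mu.-integrable `]a, b[ (EFin \o v n).
  apply: le_integrable iw => //; first by apply/measurable_EFinP; exact: mv.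
  by move=> x _ /=; rewrite lee_fin.
have muD : mu `]a, b[%classic = (b - a)%:E.
  by rewrite /mu lebesgue_measure_itv/= lte_fin ab.
have step n : ((F b - F a)%:E <= \int[mu]_(x in `]a, b[) (v n x)%:E)%E.
  pose Fn (x : R) := F x + n%:R * x.
  pose vn x := v n x + n%:R.
  have cMn (G : set_system R) (l : R) : Filter G -> x @[x --> G] --> l ->
      n%:R * x @[x --> G] --> n%:R * l.
    by move=> FG Gl; apply: cvgM => //; exact: cvg_cst.
  have dFn : derivable_oo_LRcontinuous Fn a b.
    split.
    - move=> x xab; apply: derivableD; first exact: dF.
      by apply: derivableM; [exact: derivable_cst|exact: derivable_id].
    - by apply: cvgD => //; apply: cMn; apply: cvg_at_right_filter; exact: cvg_id.
    - by apply: cvgD => //; apply: cMn; apply: cvg_at_left_filter; exact: cvg_id.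
  have mvn : measurable_fun `]a, b[ vn by apply: measurable_funD => //; exact: mv.
  have vn0 x : x \in `]a, b[ -> 0 <= vn x.
    by move=> _; rewrite -lerBlDr sub0r le_max lexx orbT.
  have Fvn x : x \in `]a, b[ -> derive1 Fn x <= vn x.
    move=> xab.
    have -> : derive1 Fn x = derive1 F x + n%:R.
      rewrite !derive1E deriveD; last 2 first.
      - exact: dF.
      - by apply: derivableM; [exact: derivable_cst|exact: derivable_id].
      congr (_ + _).
      by rewrite deriveM// derive_id derive_cst scaler0 addr0 /GRing.scale/= mulr1.
    by rewrite lerD2r le_max Fw.
  have := increment_le_integral ab dFn mvn vn0 Fvn.
  rewrite -/mu.
  have -> : (\int[mu]_(x in `]a, b[) (vn x)%:E =
             \int[mu]_(x in `]a, b[) (v n x)%:E + (n%:R * (b - a))%:E)%E.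
    under eq_integral do rewrite /vn EFinD.
    rewrite integralD; [|exact: mD|exact: iv|].
      congr (_ + _)%E.
      rewrite integral_cst; last exact: mD.
      by rewrite [X in (_ * X)%E](muD).
    apply/integrableP; split; first exact: measurable_cst.
    under eq_integral do rewrite abse_EFin.
    rewrite integral_cst; last exact: mD.
    by rewrite [X in (_ * X)%E](muD) -EFinM ltry.
  rewrite (_ : Fn b - Fn a = F b - F a + n%:R * (b - a)); last by rewrite /Fn; ring.
  by rewrite EFinD leeD2rE.
have cv : (\int[mu]_(x in `]a, b[) (v n x)%:E)%E @[n --> \oo] -->
    (\int[mu]_(x in `]a, b[) (w x)%:E)%E.
  apply: (@dominated_cvg _ _ _ lebesgue_measure _ mD (fun n x => (v n x)%:E)
    (fun x => (w x)%:E) (fun x => `|(w x)%:E|%E)).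
  - by move=> n; apply/measurable_EFinP; exact: mv.
  - move=> x _; apply: cvg_near_cst; near=> n; congr EFin; apply/max_idPl.
    rewrite lerNl; near: n.
    exact: nbhs_infty_ger.
  - by [].
  - exact: integrable_abse.
  - by move=> n x _; rewrite /= lee_fin.
rewrite -lee_fin; rewrite /Rintegral fineK; last exact: integrable_fin_num.
by apply: (cvge_to_ge cv); apply: nearW => n; exact: step.
Unshelve. all: by end_near.
Qed.

(** The one-sided inequality is applied to [F] and to [- F]. *)
Theorem Rintegral_derive1 (R : realType) (a b : R) (F w : R -> R) :
  let mu := @lebesgue_measure R in
  a < b -> derivable_oo_LRcontinuous F a b ->
  mu.-integrable `]a, b[ (EFin \o w) ->
  (forall x, x \in `]a, b[ -> derive1 F x = w x) ->
  \int[mu]_(x in `]a, b[) w x = F b - F a.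
Proof.
move=> mu ab dF iw Fw; apply/eqP; rewrite eq_le; apply/andP; split; last first.
  by apply: increment_le_Rintegral => // x xab; rewrite Fw.
have dNF : derivable_oo_LRcontinuous (fun x => - F x) a b.
  case: dF => dF Fa Fb; split.
  - by move=> x xab; apply: derivableN; exact: dF.
  - exact: cvgN.
  - exact: cvgN.
have iNw : mu.-integrable `]a, b[ (EFin \o (fun x => - w x)).
  exact: integrableN iw.
have := increment_le_Rintegral ab dNF iNw _.
under eq_Rintegral do rewrite -mulN1r.
rewrite RintegralZl// mulN1r -opprD lerN2; apply => x xab.
by rewrite derive1N ?Fw//; case: dF => dF _ _; exact: dF.
Qed.

(** * Gamma has no zero in the right half-plane *)

Lemma sqr_sin_le (R : realType) (v : R) : sin v ^+ 2 <= v ^+ 2.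
Proof.
wlog v0 : v / 0 < v => [H|].
  have [v0|v0|<-] := ltgtP 0 v; [exact: H| |by rewrite sin0].
  by have := H (- v); rewrite oppr_gt0 => /(_ v0); rewrite sinN !sqrrN.
have [|c _] := @MVT _ (@sin R) (@cos R) 0 v v0.
  by apply: continuous_subspaceT => x; exact: continuous_sin.
rewrite sin0 !subr0 => ->; rewrite exprMn.
by rewrite ler_piMl ?sqr_ge0// cos2sin2 lerBlDr lerDl sqr_ge0.
Qed.

Lemma cos_ge1Bsqr (R : realType) (u : R) : 1 - u ^+ 2 / 2 <= cos u.
Proof.
have -> : cos u = 1 - 2 * sin (u / 2) ^+ 2.
  rewrite {1}(_ : u = (u / 2) *+ 2); last by rewrite -mulr_natr divfK.
  by rewrite cos_mulr2n cos2sin2; ring.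
have := sqr_sin_le (u / 2); rewrite expr_div_n; lra.
Qed.

(** By symmetry take [0 <= L], and put [r = exp (L / 2)]. The right-hand side is the square of
    [2 (r - 1 / r)], where [r >= 1 + L / 2] and [1 / r <= 1]. *)
Lemma sqr_le_expR (R : realType) (L : R) :
  L ^+ 2 <= 4 * (expR L - 2 + expR (- L)).
Proof.
wlog L0 : L / 0 <= L => [H|].
  have [L0|L0] := leP 0 L; first exact: H.
  have := H (- L); rewrite oppr_ge0 opprK sqrrN => /(_ (ltW L0)).
  by rewrite (_ : expR (- L) - 2 + expR L = expR L - 2 + expR (- L)); last ring.
pose r := expR (L / 2).
have rE : expR L = r ^+ 2 by rewrite -expRM_natl mulrC divfK.
have r1 : 1 <= r by rewrite -expR0 ler_expR divr_ge0.
have Lr : 1 + L / 2 <= r by exact: expR_ge1Dx.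
have rV : r^-1 <= 1 by rewrite invf_le1// (lt_le_trans _ r1).
have r0 : r != 0 by rewrite gt_eqF// (lt_le_trans _ r1).
have -> : 4 * (expR L - 2 + expR (- L)) = (2 * (r - r^-1)) ^+ 2.
  by rewrite expRN rE; field.
rewrite ler_sqr ?nnegrE//; last first.
  by rewrite mulr_ge0// subr_ge0 (le_trans rV).
lra.
Qed.

Lemma ln_le_subr1 (R : realType) (u : R) : 0 < u -> ln u <= u - 1.
Proof.
by move=> u0; have := expR_ge1Dx (ln u); rewrite lnK// lerBrDl.
Qed.

(** The tangent bound [ln u <= u - 1] at [u = t / m], scaled by [m]; it says that [t^m e^-t] is
    largest at [t = m]. *)
Lemma mulr_ln_le (R : realType) (m t : R) : 0 < m -> 0 < t ->
  m * ln t <= m * ln m - m + t.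
Proof.
move=> m0 t0; have : ln (t / m) <= t / m - 1 by rewrite ln_le_subr1// divr_gt0.
rewrite ln_div ?posrE// lerBlDr => /(ler_wpM2l (ltW m0)).
by rewrite mulrDr mulrBr mulr1 mulrCA divff ?gt_eqF// mulr1; lra.
Qed.

(** * Integrals over the positive half-line *)

Lemma itv0y_bigcup (R : realType) : `]0, +oo[%classic =
  \bigcup_n `]expR (- n%:R), expR n%:R[%classic :> set R.
Proof.
apply/seteqP; split => t /=.
  rewrite in_itv/= andbT => t0.
  have [n Hn] : exists n : nat, `|ln t| < n%:R.
    by exists (Num.trunc `|ln t|).+1; exact: truncnS_gt.
  exists n => //=; rewrite in_itv/= -[t]lnK ?posrE//.
  by rewrite !ltr_expR -ltr_norml.
by case=> n _ /=; rewrite !in_itv/= andbT => /andP[+ _]; apply: lt_trans; exact: expR_gt0.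
Qed.

(** A comparison test. On each interval of the exhaustion the increment inequality for [- F] and
    [- w] bounds the integral of [w] by the increment of [F], hence by [B]; monotone convergence
    concludes. *)
Lemma integrable_bounded_primitive (R : realType) (F w : R -> R) (B : R) :
  let mu := @lebesgue_measure R in
  measurable_fun setT w -> (forall t, 0 < t -> {for t, continuous w}) ->
  (forall t, 0 < t -> derivable F t 1) ->
  (forall t, 0 < t -> 0 <= w t <= derive1 F t) ->
  (forall t, 0 < t -> 0 <= F t <= B) ->
  mu.-integrable `]0, +oo[ (EFin \o w).
Proof.
move=> mu mw cw dF wF FB.
have mwE : measurable_fun setT (EFin \o w) by exact/measurable_EFinP.
pose I n : set R := `]expR (- n%:R), expR n%:R[%classic.
have Ipos n t : I n t -> 0 < t.
  by rewrite /I/= in_itv/= => /andP[+ _]; apply: lt_trans; exact: expR_gt0.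
have step n : (\int[mu]_(t in I n) (w t)%:E <= B%:E)%E.
  (* For [n = 0] the interval []1, 1[] is empty and the bound reduces to [0 <= B], read off from
     [F 1]. *)
  have [n0|n0] := leqP n 0.
    rewrite (_ : I n = set0).
      by rewrite integral_set0 lee_fin; have /andP[] := FB 1 ltr01; exact: le_trans.
    move: n0; rewrite leqn0 => /eqP ->; rewrite /I oppr0.
    by apply/seteqP; split => t //=; rewrite in_itv/= => /andP[/lt_trans H /H]; rewrite ltxx.
  have ab : expR (- n%:R) < expR n%:R :> R.
    by rewrite ltr_expR; apply: (@lt_trans _ _ 0); rewrite ?oppr_lt0 ltr0n.
  have a0 : 0 < expR (- n%:R) :> R by exact: expR_gt0.
  have dNF : derivable_oo_LRcontinuous (fun t => - F t) (expR (- n%:R)) (expR n%:R).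
    have cF (t : R) : 0 < t -> F x @[x --> t] --> F t.
      by move=> t0; apply: differentiable_continuous; apply/derivable1_diffP; exact: dF.
    split.
    - by move=> t /Ipos t0; apply: derivableN; exact: dF.
    - by apply: cvgN; apply: cvg_at_right_filter; exact: cF.
    - by apply: cvgN; apply: cvg_at_left_filter; apply: cF; exact: expR_gt0.
  have iw : mu.-integrable (I n) (EFin \o w).
    apply: (@integrableS _ _ _ mu `[expR (- n%:R), expR n%:R]%classic).
    - exact: measurable_itv.
    - exact: measurable_itv.
    - exact: subset_itv_oo_cc.
    - apply: continuous_compact_integrable; first exact: segment_compact.
      apply: continuous_in_subspaceT => t; rewrite inE/= in_itv/= => /andP[at_ _].
      by apply: cw; exact: lt_le_trans at_.
  have iNw : mu.-integrable (I n) (EFin \o (fun t => - w t)).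
    exact: integrableN iw.
  have := increment_le_Rintegral ab dNF iNw.
  under eq_Rintegral do rewrite -mulN1r.
  rewrite RintegralZl; [|exact: measurable_itv|exact: iw].
  rewrite mulN1r -opprD lerN2 => H.
  rewrite -(@fineK _ (\int[mu]_(t in I n) (w t)%:E)%E); last first.
    by apply: integrable_fin_num => //; exact: measurable_itv.
  rewrite lee_fin; apply: (le_trans (H _)).
    move=> t /Ipos t0; rewrite derive1N; last exact: dF.
    by rewrite lerN2; have /andP[] := wF _ t0.
  rewrite lerBlDr ler_wpDr//; first by have /andP[] := FB _ a0.
  by have /andP[] := FB (expR n%:R) (expR_gt0 _).
have w0 t : 0 < t -> 0 <= w t by move=> /wF/andP[].
apply/integrableP; split.
  by apply: measurable_funS mwE.
apply: (@le_lt_trans _ _ (\int[mu]_(t in `]0%R, +oo[) (w t)%:E)%E).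
  rewrite le_eqVlt; apply/orP; left; apply/eqP; apply: eq_integral => t.
  rewrite inE/= in_itv/= andbT => t0.
  by rewrite /= ger0_norm// w0.
have cv : (\int[mu]_(t in I n) (w t)%:E)%E @[n --> \oo] -->
    (\int[mu]_(t in `]0%R, +oo[) (w t)%:E)%E.
  rewrite itv0y_bigcup.
  apply: (@ge0_nondecreasing_set_cvg_integral _ (measurableTypeR R) R I
    (EFin \o w) lebesgue_measure).
  - apply/nondecreasing_seqP => n; apply/subsetPset => t.
    rewrite /I/= !in_itv/= => /andP[nt tn].
    have nn : n%:R <= n.+1%:R :> R by rewrite ler_nat.
    rewrite (le_lt_trans _ nt) ?ler_expR ?lerN2//=.
    by rewrite (lt_le_trans tn)// ler_expR.
  - by move=> n; exact: measurable_itv.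
  - by move=> n; apply: measurable_funS mwE.
  - by move=> n t /Ipos t0; rewrite lee_fin w0.
apply: (@le_lt_trans _ _ B%:E); last by rewrite ltry.
by apply: (cvge_to_le cv); apply: nearW.
Qed.

(** The integral over []exp (-n), exp n[] is an increment of [F], which tends to [0]; by dominated
    convergence it also tends to the integral over the half-line. *)
Lemma Rintegral_derive1_0y (R : realType) (F w : R -> R) :
  let mu := @lebesgue_measure R in
  (forall t, 0 < t -> derivable F t 1) ->
  (forall t, 0 < t -> derive1 F t = w t) ->
  mu.-integrable `]0, +oo[ (EFin \o w) ->
  F (expR (- n%:R)) @[n --> \oo] --> 0 -> F (expR n%:R) @[n --> \oo] --> 0 ->
  \int[mu]_(t in `]0, +oo[) w t = 0.
Proof.
move=> mu dF Fw iw F0 Fy.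
have mD : measurable (`]0, +oo[%classic : set R) by exact: measurable_itv.
pose I n : set R := `]expR (- n%:R), expR n%:R[%classic.
have ID n : I n `<=` `]0, +oo[%classic.
  by move=> t; rewrite /I/= !in_itv/= andbT => /andP[+ _]; apply: lt_trans; exact: expR_gt0.
have mI n : measurable (I n) by exact: measurable_itv.
have mw : measurable_fun (`]0, +oo[%classic : set R) (EFin \o w) by exact: measurable_int iw.
have IE n : (0 < n)%N -> (\int[mu]_(t in I n) (w t)%:E)%E = (F (expR n%:R) - F (expR (- n%:R)))%:E.
  move=> n0.
  have ab : expR (- n%:R) < expR n%:R :> R.
    by rewrite ltr_expR; apply: (@lt_trans _ _ 0); rewrite ?oppr_lt0 ltr0n.
  have cF (t : R) : 0 < t -> F x @[x --> t] --> F t.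
    by move=> t0; apply: differentiable_continuous; apply/derivable1_diffP; exact: dF.
  have iwn : mu.-integrable (I n) (EFin \o w).
    by apply: (@integrableS _ _ _ mu `]0, +oo[%classic); [exact: mD|exact: mI|exact: ID|exact: iw].
  rewrite -(@Rintegral_derive1 _ _ _ F w)//.
  - by rewrite /Rintegral fineK//; exact: integrable_fin_num.
  - split.
    + by move=> t /ID/=; rewrite in_itv/= andbT => t0; exact: dF.
    + by apply: cvg_at_right_filter; apply: cF; exact: expR_gt0.
    + by apply: cvg_at_left_filter; apply: cF; exact: expR_gt0.
  - by move=> t /ID/=; rewrite in_itv/= andbT => t0; exact: Fw.
have cv1 : (\int[mu]_(t in I n) (w t)%:E)%E @[n --> \oo] --> (0 : \bar R)%E.
  apply: (@cvg_trans _ ((F (expR n%:R) - F (expR (- n%:R)))%:E @[n --> \oo])).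
    apply: near_eq_cvg; near=> n; rewrite IE//; near: n; exact: nbhs_infty_gt.
  apply: cvg_EFin; first by apply: nearW.
  by rewrite -(subr0 0); exact: cvgB.
have cv2 : (\int[mu]_(t in I n) (w t)%:E)%E @[n --> \oo] -->
    (\int[mu]_(t in `]0%R, +oo[) (w t)%:E)%E.
  rewrite (_ : (fun n => _) =
      (fun n => \int[mu]_(t in `]0%R, +oo[) ((EFin \o w) \_ (I n)) t)%E); last first.
    by apply/funext => n; rewrite -integral_mkcondr (setIidr (ID n)).
  apply: (@dominated_cvg _ _ _ lebesgue_measure _ mD _
    (fun x => (w x)%:E) (fun x => `|(w x)%:E|%E)).
  - move=> n; apply/measurable_restrict => /=; [exact: mI|exact: mD|].
    by apply: measurable_funS mw; [exact: mD|move=> t []].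
  - move=> t; rewrite itv0y_bigcup => -[m _ Imt].
    apply: cvg_near_cst; near=> n; rewrite /restrict patchE mem_set//.
    have mn : m%:R <= n%:R :> R by rewrite ler_nat; near: n; exact: nbhs_infty_ge.
    move: Imt; rewrite /I/= !in_itv/= => /andP[nt tn].
    rewrite (le_lt_trans _ nt) ?ler_expR ?lerN2//=.
    by rewrite (lt_le_trans tn)// ler_expR.
  - by [].
  - exact: integrable_abse.
  - move=> n t _; rewrite patchE; case: ifP => //= _.
    by rewrite normr0 lee_fin.
by rewrite /Rintegral -(cvg_lim _ cv2)// (cvg_lim _ cv1).
Unshelve. all: by end_near.
Qed.

Section real_valued_integrable.
Context d (T : measurableType d) (R : realType) (mu : {measure set T -> \bar R}).
Variables (D : set T) (mD : measurable D).

Lemma integrable_EFinZ (k : R) (f : T -> R) :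
  mu.-integrable D (EFin \o f) -> mu.-integrable D (EFin \o (fun t => k * f t)).
Proof. by move=> /(integrableZl mD k); exact: eq_integrable. Qed.

Lemma integrable_EFinD (f g : T -> R) :
  mu.-integrable D (EFin \o f) -> mu.-integrable D (EFin \o g) ->
  mu.-integrable D (EFin \o (fun t => f t + g t)).
Proof. by move=> mf mg; have := integrableD mD mf mg; exact: eq_integrable. Qed.

Lemma integrable_EFinB (f g : T -> R) :
  mu.-integrable D (EFin \o f) -> mu.-integrable D (EFin \o g) ->
  mu.-integrable D (EFin \o (fun t => f t - g t)).
Proof. by move=> mf mg; have := integrableB mD mf mg; exact: eq_integrable. Qed.

End real_valued_integrable.

(* [t^x e^-t] for [t > 0] *)
Definition gamma_density (R : realType) (x t : R) : R := expR (x * ln t - t).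

Lemma gamma_density_gt0 (R : realType) (x t : R) : 0 < gamma_density x t.
Proof. exact: expR_gt0. Qed.

Lemma gamma_densityD1 (R : realType) (x t : R) : 0 < t ->
  gamma_density (x + 1) t = gamma_density x t * t.
Proof.
move=> t0; rewrite /gamma_density -{5}(lnK t0) -expRD; congr expR; ring.
Qed.

Lemma gamma_density_le (R : realType) (x t : R) : 0 < x -> 0 < t ->
  gamma_density x t <= expR (x * ln x - x).
Proof.
move=> x0 t0; rewrite ler_expR lerBlDr; exact: mulr_ln_le.
Qed.

Lemma is_derive_gamma_density (R : realType) (x t : R) : 0 < t ->
  is_derive t 1 (gamma_density x) (gamma_density x t * (x / t - 1)).
Proof.
move=> t0; have dln := is_derive1_ln t0.
have d1 : is_derive t 1 (fun t => x * ln t - t) (x / t - 1).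
  have -> : (fun t => x * ln t - t) = (x *: @ln R - id) by [].
  exact: is_derive_eq.
have -> : gamma_density x = expR \o (fun t => x * ln t - t) by [].
by apply: is_derive_eq; rewrite /= mulrC.
Qed.

Lemma continuous_gamma_density (R : realType) (x t : R) : 0 < t ->
  {for t, continuous (gamma_density x)}.
Proof.
move=> t0; apply: differentiable_continuous; apply/derivable1_diffP.
by case: (is_derive_gamma_density x t0).
Qed.

Lemma measurable_gamma_density (R : realType) (x : R) :
  measurable_fun setT (gamma_density x).
Proof.
apply: measurableT_comp; first exact: measurable_expR.
apply: measurable_funB; last exact: measurable_id.
by apply: measurable_funM; [exact: measurable_cst|exact: measurable_ln].
Qed.

Lemma integrable_gamma_density (R : realType) (x : R) : 0 < x ->
  (@lebesgue_measure R).-integrable `]0, +oo[ (EFin \o gamma_density (x - 1)).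
Proof.
move=> x0.
(* [t^(x-1) e^-t] is at most the derivative of [C (t / (1 + t))^x]. *)
pose k := (x + 1) * ln (x + 1) - (x + 1) + 1.
pose C := expR k / x.
have C0 : 0 <= C by rewrite divr_ge0 ?expR_ge0// ltW.
pose G (t : R) := x * (ln t - ln (1 + t)).
have dF (t : R) : 0 < t -> is_derive t 1 (fun t => C * expR (G t))
    (C * (expR (G t) * (x * (t^-1 - (1 + t)^-1)))).
  move=> t0; have dln := is_derive1_ln t0.
  have t10 : 0 < 1 + t by rewrite addr_gt0.
  have dln1 : is_derive t 1 (fun t => ln (1 + t)) (1 + t)^-1.
    have dln1 := is_derive1_ln t10.
    have -> : (fun t => ln (1 + t)) = @ln R \o (cst 1 + id) by [].
    by apply: is_derive_eq; rewrite add0r mulr1.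
  have dG : is_derive t 1 G (x * (t^-1 - (1 + t)^-1)).
    have -> : G = x *: (@ln R - (fun t => ln (1 + t))) by [].
    exact: is_derive_eq.
  have -> : (fun t => C * expR (G t)) = C *: (expR \o G) by [].
  exact: is_derive_eq.
apply: (@integrable_bounded_primitive _ (fun t => C * expR (G t)) _ C).
- exact: measurable_gamma_density.
- by move=> t; exact: continuous_gamma_density.
- by move=> t /dF [].
- move=> t t0; have [_ dE] := dF _ t0; rewrite expR_ge0/= derive1E dE.
  have t10 : 0 < 1 + t by rewrite addr_gt0.
  have -> : C * (expR (G t) * (x * (t^-1 - (1 + t)^-1))) =
      expR (k + ((x - 1) * ln t - (x + 1) * ln (1 + t))).
    have -> : t^-1 - (1 + t)^-1 = expR (- ln t - ln (1 + t)).
      rewrite expRD !expRN !lnK ?posrE//; field.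
      by rewrite !gt_eqF.
    rewrite (_ : C * _ = expR k * expR (G t) * expR (- ln t - ln (1 + t))).
      by rewrite -!expRD; congr expR; rewrite /G; ring.
    by rewrite /C; field; rewrite gt_eqF.
  rewrite ler_expR.
  (* The derivative of the majorant is [e^k t^(x-1) / (1+t)^(x+1)], so the claim amounts to
     [(1+t)^(x+1) <= e^(k+t)]; [k] is the constant that [mulr_ln_le] gives for [m = x + 1] at the
     point [1 + t]. *)
  have : (x + 1) * ln (1 + t) <= k + t.
    have x10 : 0 < x + 1 by rewrite addr_gt0.
    by have := mulr_ln_le x10 t10; rewrite /k; lra.
  lra.
- move=> t t0; rewrite mulr_ge0 ?expR_ge0//= ler_piMr// expR_le1.
  rewrite /G mulr_ge0_le0 ?(ltW x0)// subr_le0 ler_ln ?posrE ?addr_gt0//.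
  by rewrite lerDr.
Qed.

Lemma integrable_gamma_densityM (R : realType) (x : R) (h : R -> R) : 0 < x ->
  measurable_fun setT h -> (forall t, `|h t| <= 1) ->
  (@lebesgue_measure R).-integrable `]0, +oo[
    (EFin \o (fun t => gamma_density (x - 1) t * h t)).
Proof.
move=> x0 mh h1; apply: le_integrable (integrable_gamma_density x0).
- exact: measurable_itv.
- apply/measurable_EFinP; apply: (@measurable_funS _ _ _ _ setT) => //.
  by apply: measurable_funM => //; exact: measurable_gamma_density.
- move=> t _ /=; rewrite lee_fin normrM ler_piMr//.
Qed.

Lemma norm_gamma_densityM_le (R : realType) (x t : R) (h : R -> R) :
  (forall t, `|h t| <= 1) -> `|gamma_density x t * h t| <= gamma_density x t.
Proof.
move=> h1; have g0 := gamma_density_gt0 x t.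
by rewrite normrM (gtr0_norm g0) ler_piMr// ltW.
Qed.

(** Integrate the derivative of [t^x e^-t h t], which is the integrand of the right-hand side minus
    that of the left-hand side. The boundary terms vanish because [h] is bounded. The pair [h], [k]
    stands for the cosine and sine of [y ln t], in either order, with [c = - y] or [c = y]. *)
Lemma Rintegral_gamma_density_parts (R : realType) (x c : R) (h k : R -> R) :
  let mu := @lebesgue_measure R in
  0 < x -> measurable_fun setT h -> measurable_fun setT k ->
  (forall t, `|h t| <= 1) -> (forall t, `|k t| <= 1) ->
  (forall t : R, 0 < t -> is_derive t 1 h (c * k t / t)) ->
  \int[mu]_(t in `]0, +oo[) (gamma_density x t * h t) =
  x * \int[mu]_(t in `]0, +oo[) (gamma_density (x - 1) t * h t) +
  c * \int[mu]_(t in `]0, +oo[) (gamma_density (x - 1) t * k t).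
Proof.
move=> mu x0 mh mk h1 k1 dh.
have mD : measurable (`]0, +oo[%classic : set (measurableTypeR R)) by exact: measurable_itv.
pose ih := integrable_gamma_densityM x0 mh h1.
pose ik := integrable_gamma_densityM x0 mk k1.
have ih' : mu.-integrable `]0, +oo[ (EFin \o (fun t => gamma_density x t * h t)).
  have x10 : 0 < x + 1 by rewrite addr_gt0.
  by have := integrable_gamma_densityM x10 mh h1; rewrite addrK.
pose w1 t := gamma_density (x - 1) t * h t.
pose w2 t := gamma_density (x - 1) t * k t.
pose w3 t := gamma_density x t * h t.
have i1 : mu.-integrable `]0, +oo[ (EFin \o (fun t => x * w1 t)).
  exact: (integrable_EFinZ mD x ih).
have i2 : mu.-integrable `]0, +oo[ (EFin \o (fun t => c * w2 t)).
  exact: (integrable_EFinZ mD c ik).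
have i12 : mu.-integrable `]0, +oo[ (EFin \o (fun t => x * w1 t + c * w2 t)).
  exact: (integrable_EFinD mD i1 i2).
have i123 : mu.-integrable `]0, +oo[
    (EFin \o (fun t => x * w1 t + c * w2 t - w3 t)).
  exact: (integrable_EFinB mD i12 ih').
have d3 (t : R) : 0 < t -> is_derive t 1 w3 (x * w1 t + c * w2 t - w3 t).
  move=> t0; have d1 := dh _ t0; have d2 := is_derive_gamma_density x t0.
  have -> : w3 = gamma_density x * h by [].
  apply: is_derive_eq.
  have gE : gamma_density x t = gamma_density (x - 1) t * t.
    by rewrite -gamma_densityD1// subrK.
  rewrite /w1 /w2 -[(gamma_density x * h) t]/(gamma_density x t * h t) gE.
  rewrite /GRing.scale/=.
  by field; rewrite gt_eqF.
have : \int[mu]_(t in `]0, +oo[) (x * w1 t + c * w2 t - w3 t) = 0.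
  apply: (@Rintegral_derive1_0y _ w3) => //.
  - by move=> t /d3[].
  - by move=> t /d3[_ dE]; rewrite derive1E.
  (* At [t = exp (- n)] the density is at most [t^x = exp (- x) ^ n]. *)
  - apply/norm_cvg0P.
    apply: (@squeeze_cvgr _ _ _ _ (cst 0) (fun n => expR (- x) ^+ n)).
    + apply: nearW => n; rewrite normr_ge0/=.
      apply: (le_trans (norm_gamma_densityM_le _ _ h1)).
      rewrite -expRM_natl ler_expR expRK.
      by rewrite !mulrN (mulrC x) lerBlDr lerDl expR_ge0.
    + exact: cvg_cst.
    + by apply: cvg_expr; rewrite ger0_norm ?expR_ge0// expR_lt1 oppr_lt0.
  - apply/norm_cvg0P.
    (* [M] bounds [t^(x+1) e^-t], so that [t^x e^-t <= M / t] at [t = exp n]. *)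
    pose M := expR ((x + 1) * ln (x + 1) - (x + 1)).
    apply: (@squeeze_cvgr _ _ _ _ (cst 0) (fun n => M * expR (- n%:R))).
    + apply: nearW => n; rewrite normr_ge0/=.
      apply: (le_trans (norm_gamma_densityM_le _ _ h1)).
      rewrite expRN ler_pdivlMr ?expR_gt0// -gamma_densityD1 ?expR_gt0//.
      by apply: gamma_density_le; [rewrite addr_gt0|exact: expR_gt0].
    + exact: cvg_cst.
    + rewrite -(mulr0 M); apply: cvgM; first exact: cvg_cst.
      exact: cvgn_expR.
rewrite RintegralB// RintegralD// !RintegralZl// => /eqP.
by rewrite subr_eq0 => /eqP.
Qed.

(** * Real and imaginary parts of Euler's integral *)

Definition Gamma_re (R : realType) (x y : R) : R :=
  \int[@lebesgue_measure R]_(t in `]0, +oo[) (gamma_density (x - 1) t * cos (y * ln t)).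

Definition Gamma_im (R : realType) (x y : R) : R :=
  \int[@lebesgue_measure R]_(t in `]0, +oo[) (gamma_density (x - 1) t * sin (y * ln t)).

Lemma measurable_cosMln (R : realType) (y : R) : measurable_fun setT (fun t => cos (y * ln t)).
Proof.
apply: measurableT_comp; first by apply: continuous_measurable_fun; exact: continuous_cos.
by apply: measurable_funM; [exact: measurable_cst|exact: measurable_ln].
Qed.

Lemma measurable_sinMln (R : realType) (y : R) : measurable_fun setT (fun t => sin (y * ln t)).
Proof.
apply: measurableT_comp; first by apply: continuous_measurable_fun; exact: continuous_sin.
by apply: measurable_funM; [exact: measurable_cst|exact: measurable_ln].
Qed.

Lemma is_derive_Mln (R : realType) (y t : R) : 0 < t ->
  is_derive t 1 (fun t => y * ln t) (y / t).
Proof.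
move=> t0; have dln := is_derive1_ln t0.
have -> : (fun t => y * ln t) = y *: @ln R by [].
exact: is_derive_eq.
Qed.

(** With [Gamma_imD1], this is the functional equation [Gamma (z + 1) = z Gamma z] at [z = x + i y],
    split into real and imaginary parts. *)
Lemma Gamma_reD1 (R : realType) (x y : R) : 0 < x ->
  Gamma_re (x + 1) y = x * Gamma_re x y - y * Gamma_im x y.
Proof.
move=> x0; rewrite /Gamma_re /Gamma_im addrK -mulNr.
apply: Rintegral_gamma_density_parts => //.
- exact: measurable_cosMln.
- exact: measurable_sinMln.
- by move=> t; exact: cos_max.
- by move=> t; exact: sin_max.
- move=> t t0; have d := is_derive_Mln y t0.
  have -> : (fun t => cos (y * ln t)) = cos \o (fun t => y * ln t) by [].
  by apply: is_derive_eq; rewrite /=; ring.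
Qed.

Lemma Gamma_imD1 (R : realType) (x y : R) : 0 < x ->
  Gamma_im (x + 1) y = x * Gamma_im x y + y * Gamma_re x y.
Proof.
move=> x0; rewrite /Gamma_re /Gamma_im addrK.
apply: Rintegral_gamma_density_parts => //.
- exact: measurable_sinMln.
- exact: measurable_cosMln.
- by move=> t; exact: sin_max.
- by move=> t; exact: cos_max.
- move=> t t0; have d := is_derive_Mln y t0.
  have -> : (fun t => sin (y * ln t)) = sin \o (fun t => y * ln t) by [].
  by apply: is_derive_eq; rewrite /=; ring.
Qed.

Lemma integrable_Gamma_re (R : realType) (x y : R) : 0 < x ->
  (@lebesgue_measure R).-integrable `]0, +oo[
    (EFin \o (fun t => gamma_density (x - 1) t * cos (y * ln t))).
Proof.
move=> x0; apply: integrable_gamma_densityM => //; first exact: measurable_cosMln.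
by move=> t; exact: cos_max.
Qed.

Lemma integrable_Gamma_im (R : realType) (x y : R) : 0 < x ->
  (@lebesgue_measure R).-integrable `]0, +oo[
    (EFin \o (fun t => gamma_density (x - 1) t * sin (y * ln t))).
Proof.
move=> x0; apply: integrable_gamma_densityM => //; first exact: measurable_sinMln.
by move=> t; exact: sin_max.
Qed.

(** The second argument [0] turns the cosine into [1], and on []1, 2[] the density [t^(x-1) e^-t] is
    at least [e^-2], since [x > 1]. *)
Lemma Gamma_re0_gt0 (R : realType) (x : R) : 1 < x -> 0 < Gamma_re x 0.
Proof.
move=> x1; have ig := integrable_Gamma_re 0 (lt_trans ltr01 x1).
pose g t := gamma_density (x - 1) t * cos (0 * ln t).
have gE t : g t = gamma_density (x - 1) t by rewrite /g mul0r cos0 mulr1.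
have mg : measurable_fun setT (EFin \o g).
  apply/measurable_EFinP; apply: measurable_funM.
  - exact: measurable_gamma_density.
  - exact: measurable_cosMln.
apply: (@lt_le_trans _ _ (expR (- 2))); first exact: expR_gt0.
rewrite -lee_fin /Gamma_re /Rintegral fineK; last exact: integrable_fin_num ig.
apply: (@le_trans _ _ (\int[lebesgue_measure]_(t in `]1%R, 2%R[) (g t)%:E)%E); last first.
  apply: ge0_subset_integral.
  - exact: measurable_itv.
  - exact: measurable_itv.
  - exact: measurable_funS mg.
  - by move=> t _; rewrite /= gE lee_fin ltW// gamma_density_gt0.
  - by move=> t /=; rewrite !in_itv/= andbT => /andP[+ _]; exact: lt_trans.
apply: (@le_trans _ _ (\int[lebesgue_measure]_(t in `]1%R, 2%R[) cst (expR (- 2))%:E t)%E).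
  rewrite integral_cst; last exact: measurable_itv.
  have mu12 : @lebesgue_measure R `]1, 2[%classic = 1%:E.
    by rewrite lebesgue_measure_itv/= lte_fin ltr1n -EFinB (_ : 2 - 1 = 1)//; lra.
  by rewrite [X in (_ * X)%E](mu12) mule1.
apply: ge0_le_integral.
- exact: measurable_itv.
- by move=> t _ /=; rewrite lee_fin expR_ge0.
- exact: measurable_cst.
- exact: measurable_funS mg.
- move=> t /=; rewrite in_itv/= => /andP[t1 t2].
  rewrite gE lee_fin ler_expR lerBrDr.
  have : 0 <= (x - 1) * ln t.
    by rewrite mulr_ge0 ?ln_ge0 ?subr_ge0// ltW.
  lra.
Qed.

(** The condition [2 y^2 < x - 1] makes [Gamma x * (1 - 2 y^2 / (x - 1))] positive, and this is a
    lower bound for an integral that would be [0] if both parts vanished. *)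
Lemma Gamma_re_im_neq0_large (R : realType) (x y : R) :
  1 < x -> 2 * y ^+ 2 < x - 1 -> Gamma_re x y = 0 -> Gamma_im x y = 0 -> False.
Proof.
move=> x1 yx re0 im0.
have x0 : 0 < x by exact: lt_trans x1.
have x10 : 0 < x - 1 by rewrite subr_gt0.
have mD : measurable (`]0, +oo[%classic : set (measurableTypeR R)) by exact: measurable_itv.
have ic := integrable_Gamma_re y x0; have is_ := integrable_Gamma_im y x0.
have i0 := integrable_Gamma_re 0 x0; have im := integrable_Gamma_re 0 x10.
have ip : lebesgue_measure.-integrable `]0, +oo[
    (EFin \o (fun t : R => gamma_density x t * cos (0 * ln t))).
  by have := @integrable_Gamma_re _ (x + 1) 0; rewrite addrK; apply; rewrite addr_gt0.
have A0 := Gamma_re0_gt0 x1.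
(* The factors [t / x] and [x / t] shift the argument to [x + 1] and [x - 1]; both values are
   related to the one at [x]. *)
have Ap : Gamma_re (x + 1) 0 = x * Gamma_re x 0 by rewrite Gamma_reD1// mul0r subr0.
have Am : Gamma_re x 0 = (x - 1) * Gamma_re (x - 1) 0.
  have := Gamma_reD1 0 x10; rewrite subrK mul0r subr0; exact.
have iu := integrable_EFinD mD (integrable_EFinZ mD (cos (y * ln x)) ic)
  (integrable_EFinZ mD (sin (y * ln x)) is_).
have il := integrable_EFinB mD (integrable_EFinB mD
  (integrable_EFinZ mD (1 + 4 * y ^+ 2) i0)
  (integrable_EFinZ mD (2 * y ^+ 2 / x) ip))
  (integrable_EFinZ mD (2 * y ^+ 2 * x) im).
(* The integrand is the real part of [x^(-iy) t^(x-1+iy) e^-t]; its integral is a combination of the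
   two parts assumed to vanish. *)
have EU : \int[lebesgue_measure]_(t in `]0, +oo[)
    (cos (y * ln x) * (gamma_density (x - 1) t * cos (y * ln t)) +
     sin (y * ln x) * (gamma_density (x - 1) t * sin (y * ln t))) = 0.
  rewrite RintegralD; [|exact: mD|exact: (integrable_EFinZ mD _ ic)|
    exact: (integrable_EFinZ mD _ is_)].
  rewrite !(RintegralZl _ mD); [|exact: is_|exact: ic].
  by rewrite -/(Gamma_re x y) -/(Gamma_im x y) re0 im0 !mulr0 addr0.
(* The integrand is [t^(x-1) e^-t (1 - 2 y^2 (t/x - 2 + x/t))], with the powers of [t] absorbed into
   the density. *)
have EL : \int[lebesgue_measure]_(t in `]0, +oo[)
    ((1 + 4 * y ^+ 2) * (gamma_density (x - 1) t * cos (0 * ln t)) -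
     2 * y ^+ 2 / x * (gamma_density x t * cos (0 * ln t)) -
     2 * y ^+ 2 * x * (gamma_density (x - 1 - 1) t * cos (0 * ln t))) =
    Gamma_re x 0 * (1 - 2 * y ^+ 2 / (x - 1)).
  rewrite RintegralB; [|exact: mD| |exact: (integrable_EFinZ mD _ im)]; last first.
    exact: (integrable_EFinB mD (integrable_EFinZ mD _ i0) (integrable_EFinZ mD _ ip)).
  rewrite RintegralB; [|exact: mD|exact: (integrable_EFinZ mD _ i0)|
    exact: (integrable_EFinZ mD _ ip)].
  rewrite !(RintegralZl _ mD); [|exact: im|exact: ip|exact: i0].
  rewrite -/(Gamma_re x 0) -/(Gamma_re (x - 1) 0).
  have -> : \int[lebesgue_measure]_(t in `]0, +oo[)
      (gamma_density x t * cos (0 * ln t)) = Gamma_re (x + 1) 0.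
    by rewrite /Gamma_re addrK.
  rewrite Ap Am; field.
  by rewrite !gt_eqF.
have : Gamma_re x 0 * (1 - 2 * y ^+ 2 / (x - 1)) <= 0.
  rewrite -EL; apply: (le_trans (le_Rintegral mD il iu _)); last first.
    by rewrite le_eqVlt; apply/orP; left; apply/eqP; exact: EU.
  move=> t.
  rewrite /= in_itv/= andbT => t0.
  pose L := ln t - ln x.
  have eL : expR L = t / x by rewrite expRB !lnK.
  have eNL : expR (- L) = x / t by rewrite expRN eL invf_div.
  rewrite mul0r cos0 !mulr1.
  have -> : cos (y * ln x) * (gamma_density (x - 1) t * cos (y * ln t)) +
      sin (y * ln x) * (gamma_density (x - 1) t * sin (y * ln t)) =
      gamma_density (x - 1) t * cos (y * L).
    by rewrite /L mulrBr cosB; ring.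
  have g1 : gamma_density x t = gamma_density (x - 1) t * t.
    by rewrite -gamma_densityD1// subrK.
  have g2 : gamma_density (x - 1 - 1) t = gamma_density (x - 1) t / t.
    by rewrite -{2}(subrK 1 (x - 1)) gamma_densityD1// mulfK// gt_eqF.
  rewrite g1 g2.
  rewrite (_ : _ - _ = gamma_density (x - 1) t *
      (1 - 2 * y ^+ 2 * (t / x - 2 + x / t))); last first.
    by field; rewrite !gt_eqF.
  rewrite ler_pM2l ?gamma_density_gt0// -eL -eNL.
  apply: le_trans (cos_ge1Bsqr _).
  rewrite lerD2l lerN2 exprMn.
  by have := ler_wpM2l (sqr_ge0 y) (sqr_le_expR L); clear; lra.
by rewrite (pmulr_rle0 _ A0) subr_le0 (ler_pdivlMr _ _ x10) mul1r leNgt yx.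
Qed.

(** A zero at [x + i y] would propagate by the recurrences to every [x + n + i y], which is excluded
    for large [n]. *)
Lemma Gamma_re_im_neq0 (R : realType) (x y : R) :
  0 < x -> Gamma_re x y = 0 -> Gamma_im x y = 0 -> False.
Proof.
move=> x0 re0 im0.
have H n : Gamma_re (x + n%:R) y = 0 /\ Gamma_im (x + n%:R) y = 0.
  elim: n => [|n [IHr IHi]]; first by rewrite addr0.
  have xn0 : 0 < x + n%:R by rewrite ltr_wpDr.
  rewrite -natr1 addrA (Gamma_reD1 _ xn0) (Gamma_imD1 _ xn0) IHr IHi.
  by rewrite !mulr0 subr0 addr0.
(* The [.+2] leaves the truncation plus one, which exceeds [2 y^2], after [1] is subtracted. *)
pose n := (Num.trunc (2 * y ^+ 2)).+2.
have yn : 2 * y ^+ 2 < n%:R - 1.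
  by rewrite /n -[X in _ < X - 1]natr1 addrK; exact: truncnS_gt.
have [] := H n; apply: Gamma_re_im_neq0_large; last by move: x0 yn; lra.
by have := sqr_ge0 y; move: x0 yn; lra.
Qed.

Lemma GammaE (R : realType) (z : R[i]) :
  Gamma z = Gamma_re (complex.Re z) (complex.Im z) +i*
            Gamma_im (complex.Re z) (complex.Im z).
Proof.
case: z => x y; rewrite /Gamma /cintegral; congr (_ +i* _).
  apply: eq_Rintegral => t; rewrite inE/= in_itv/= andbT => t0.
  rewrite /cpow /gamma_density /powR gt_eqF//= subr0 expRD; ring.
apply: eq_Rintegral => t; rewrite inE/= in_itv/= andbT => t0.
rewrite /cpow /gamma_density /powR gt_eqF//= subr0 expRD; ring.
Qed.

Theorem Gamma_neq0 (R : realType) (z : R[i]) : 0 < complex.Re z -> Gamma z != 0.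
Proof.
move=> z0; rewrite GammaE eq_complex/=; apply/negP => /andP[/eqP re0 /eqP im0].
exact: Gamma_re_im_neq0 re0 im0.
Qed.

(** * The truncated V-fractional derivative *)

(** The logarithmic derivative of the product at [0] is the sum of the [- 1 / z], each of modulus at
    most [1 / eta]. The induction uses the product rule and a form without division. *)
Lemma norm_deriv_prod_XsubC_le (K : numFieldType) (eta : K) (rs : seq K) :
  0 < eta -> all (fun z => eta <= `|z|) rs ->
  `|(\prod_(z <- rs) ('X - z%:P))^`().[0]| * eta <=
  (size rs)%:R * `|(\prod_(z <- rs) ('X - z%:P)).[0]|.
Proof.
move=> eta0; elim: rs => [_|z rs IH /= /andP[ez ers]].
  by rewrite big_nil derivC horner0 normr0 !mul0r.
rewrite big_cons; set q := \prod_(_ <- _) _ in IH *.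
rewrite derivM derivXsubC mul1r hornerD !hornerM hornerXsubC sub0r.
rewrite normrM normrN.
apply: (@le_trans _ _ ((`|q.[0]| + `|z| * `|q^`().[0]|) * eta)).
  by rewrite ler_pM2r// (le_trans (ler_normD _ _))// normrM normrN.
rewrite mulrDl -natr1 mulrDl mul1r addrC lerD//.
  by rewrite -mulrA [leRHS]mulrCA ler_wpM2l// IH.
by rewrite mulrC ler_wpM2r.
Qed.

(** If all roots had modulus at least [eta], the preceding bound, scaled by the leading coefficient,
    would contradict the hypothesis. The number of roots is one less than [size p], so the size is a
    safe bound. *)
Lemma small_root (K : numClosedFieldType) (eta : K) (p : {poly K}) :
  0 < eta -> (size p)%:R * `|p.[0]| < eta * `|p^`().[0]| ->
  exists2 z, root p z & `|z| < eta.
Proof.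
move=> eta0 H.
have p0 : p != 0.
  by apply: contraTneq H => ->; rewrite deriv0 !horner0 normr0 !mulr0 ltxx.
have [rs prs] := closed_field_poly_normal p.
have lp0 : lead_coef p != 0 by rewrite lead_coef_eq0.
have [/hasP[z zrs zeta]|] := boolP (has (fun z => `|z| < eta) rs).
  by exists z => //; rewrite prs rootZ// root_prod_XsubC.
rewrite -all_predC => ars.
have {}ars : all (fun z => eta <= `|z|) rs.
  apply: sub_all ars => z /=; rewrite real_ltNge ?negbK// gtr0_real//.
have sp : size p = (size rs).+1 by rewrite {1}prs size_scale// size_prod_XsubC.
have := norm_deriv_prod_XsubC_le eta0 ars.
move/(ler_wpM2l (normr_ge0 (lead_coef p))).
rewrite mulrA -normrM -hornerZ -derivZ mulrCA -normrM -hornerZ -prs.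
move=> H1; suff : eta * `|p^`().[0]| < eta * `|p^`().[0]| by rewrite ltxx.
rewrite {1}mulrC; apply: (le_lt_trans H1); apply: le_lt_trans H.
by rewrite ler_wpM2r// ler_nat sp.
Qed.

Lemma cvg_horner (K : numFieldType) (T : Type) (G : set_system T) (p : {poly K})
    (u : T -> K) (l : K) : Filter G ->
  u t @[t --> G] --> l -> p.[u t] @[t --> G] --> p.[l].
Proof.
move=> FG ul; elim/poly_ind: p => [|p c IH].
  have -> : (fun t => 0.[u t]) = cst 0.
    by apply/funext => t; rewrite horner0.
  by rewrite horner0; exact: cvg_cst.
have -> : (fun t => (p * 'X + c%:P).[u t]) = (fun t => p.[u t] * u t + c).
  by apply/funext => t; rewrite hornerMXaddC.
by rewrite hornerMXaddC; apply: cvgD; [exact: cvgM|exact: cvg_cst].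
Qed.

(** * Difference quotients and differentiability on a segment *)

Lemma cvg_slope (R : realType) (h : R -> R) (x : R) : derivable h x 1 ->
  (h y - h x) / (y - x) @[y --> x^'] --> derive1 h x.
Proof.
rewrite derive1E => dh U /dh [r /= r0 Hr].
exists r => //= y /= xyr yx.
have := Hr (y - x); rewrite /= sub0r normrN distrC => /(_ xyr).
by rewrite subr_eq0 => /(_ yx); rewrite scaler1 subrK -[_ *: _]/(_ * _) mulrC.
Qed.

Lemma derivable_slope (R : realType) (h : R -> R) (x : R) :
  cvg ((h y - h x) / (y - x) @[y --> x^']) -> derivable h x 1.
Proof.
move=> /cvg_ex[l hl]; apply/cvg_ex; exists l => U /hl [r /= r0 Hr].
exists r => //= t /= tr t0.
have txr : `|x - (t + x)| < r by rewrite (_ : x - (t + x) = 0 - t)//; ring.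
have tx : t + x != x by rewrite -subr_eq0 addrK.
have := Hr (t + x) txr tx; rewrite /= addrK scaler1.
by rewrite -[_ *: _]/(_ * _) mulrC.
Qed.

(** At interior points the restriction to the segment disappears close to [x]. At the ends only
    continuity is kept, which follows from convergence of the one-sided quotient. *)
Lemma differentiable_on_segment_derivable (R : realType) (a b : R) (h : R -> R) :
  a < b -> differentiable_on_segment a b h -> derivable_oo_LRcontinuous h a b.
Proof.
move=> ab dh.
(* [h y] is recovered as the quotient times [y - x], plus [h x]; [G] will be the right
   neighbourhoods of [a] or the left ones of [b]. *)
have cvg_end (x : R) (G : set_system R) : Filter G -> x \in `[a, b] ->
    G --> within `[a, b]%classic x^' -> G --> x -> h y @[y --> G] --> h x.
  move=> FG /dh/cvg_ex[l hl] Gx Gx'.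
  have Gy : (y - x) @[y --> G] --> 0 by rewrite -(subrr x); apply: cvgB => //; exact: cvg_cst.
  have Gh : (h y - h x) / (y - x) * (y - x) + h x @[y --> G] --> l * 0 + h x.
    apply: cvgD; last exact: cvg_cst.
    by apply: cvgM => //; apply: cvg_trans hl; exact: cvg_app.
  rewrite mulr0 add0r in Gh; apply: cvg_trans Gh; apply: near_eq_cvg.
  have : within `[a, b]%classic x^' [set y | y != x] by exists 1 => //= y /= _ yx _.
  by move=> /Gx; apply: filterS => y /= yx; rewrite divfK ?subr_eq0// subrK.
split.
- move=> x xab; apply: derivable_slope.
  have /dh/cvg_ex[l hl] : x \in `[a, b] by apply: subset_itv_oo_cc xab.
  apply/cvg_ex; exists l; apply: cvg_trans hl; apply: cvg_app => U [r /= r0 Hr].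
  have : \forall y \near x, y \in `]a, b[ by exact: near_in_itvoo.
  case=> r' /= r'0 Hr'; exists (Num.min r r').
    by rewrite /= lt_min r0.
  move=> y /=; rewrite lt_min => /andP[xyr xyr'] yx.
  by apply: Hr => //; apply: subset_itv_oo_cc; exact: Hr'.
- apply: cvg_end; first by rewrite bound_itvE ltW.
    move=> U [r /= r0 Hr].
    exists (Num.min r (b - a)); first by rewrite /= lt_min r0 subr_gt0.
    move=> y /=; rewrite lt_min => /andP[xyr xyb] ay.
    apply: Hr => //=; first by rewrite gt_eqF.
    rewrite in_itv/= (ltW ay)/=; move: xyb.
    by rewrite distrC gtr0_norm ?subr_gt0// ltrD2r => /ltW.
  by apply: cvg_at_right_filter; exact: cvg_id.
- apply: cvg_end; first by rewrite bound_itvE ltW.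
    move=> U [r /= r0 Hr].
    exists (Num.min r (b - a)); first by rewrite /= lt_min r0 subr_gt0.
    move=> y /=; rewrite lt_min => /andP[xyr xyb] yb.
    apply: Hr => //=; first by rewrite lt_eqF.
    rewrite in_itv/= (ltW yb) andbT; move: xyb.
    by rewrite gtr0_norm ?subr_gt0// ltrD2l ltrN2 => /ltW.
  by apply: cvg_at_left_filter; exact: cvg_id.
Qed.

Lemma cvg_real_complex (R : realType) (T : Type) (G : set_system T) (u : T -> R) (l : R) :
  Filter G -> u t @[t --> G] --> l -> ((u t)%:C : R[i]^o) @[t --> G] --> (l%:C : R[i]^o).
Proof.
move=> FG ul; apply/cvgrPdist_lt => e e0.
have eE : e = (complex.Re e)%:C by rewrite RRe_real// gtr0_real.
have re0 : 0 < complex.Re e by rewrite -ltcR -eE.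
move/cvgrPdist_lt : ul => /(_ _ re0); apply: filterS => t tl.
by rewrite -rmorphB/= eE normc_def/= expr0n/= addr0 sqrtr_sqr ltcR.
Qed.

Lemma cvg_complex_Re (R : realType) (T : Type) (G : set_system T) (u : T -> R[i]^o) (l : R[i]^o) :
  Filter G -> u t @[t --> G] --> l ->
  complex.Re (u t) @[t --> G] --> complex.Re l.
Proof.
move=> FG ul; apply/cvgrPdist_lt => e e0.
have e0C : 0 < e%:C :> R[i] by rewrite ltcR.
move/cvgrPdist_lt : ul => /(_ _ e0C); apply: filterS => t tl.
have := le_lt_trans (normc_ge_Re (l - u t : R[i])) tl.
by rewrite ltcR; case: (l) (u t) => [a b] [c d].
Qed.

(** * Limits over the points at which a complex polynomial takes real values *)

Section horner_slope.
Context (R : realType) (P : {poly R[i]}) (a b x s : R) (h : R -> R).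
Hypotheses (P0 : P.[0] = 1) (P1 : P^`().[0] != 0).
Hypotheses (axb : x \in `]a, b[) (x0 : 0 < x) (s0 : 0 < s).

(** This is [Vdomain] with [P] for [truncH] and [s] for [x^(-alpha)]. *)
Let V : set R[i] := [set e | e != 0 /\
  exists2 y, `[a, b]%classic y & x%:C * P.[e * s%:C] = y%:C].

(* With [Q = P - (1 + del)], the sum of the inverses of the roots of [Q] is
   [- Q'(0) / Q(0) = P'(0) / del], so that some root of [Q] is small if [del]
   is. *)
Lemma within_horner_real_proper : ProperFilter (within V (nbhs (0 : R[i]^o))).
Proof.
apply: Build_ProperFilter_ex => W [r /= r0 Hr].
have sC0 : 0 < s%:C :> R[i] by rewrite ltcR.
pose N : R := (size P).+1%:R.
have N0 : 0 < N by rewrite ltr0n.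
have eta0 : 0 < r * s%:C by rewrite mulr_gt0.
pose M := r * s%:C * `|P^`().[0]|.
have M0 : 0 < M by rewrite mulr_gt0// normr_gt0.
have ME : M = (complex.Re M)%:C by rewrite RRe_real// gtr0_real.
have ReM0 : 0 < complex.Re M by rewrite -ltcR -ME.
have /andP[ax xb] : a < x < b by move: axb; rewrite in_itv.
have bx0 : 0 < (b - x) / x by rewrite divr_gt0// subr_gt0.
(* The first bound keeps [x (1 + del)] at most [b]; the second gives [N * del < r s |P'(0)|], as
   [small_root] requires, with [N] bounding the size of [Q]. The factor [2] makes the inequality
   strict. *)
pose del := Num.min ((b - x) / x) (complex.Re M / (2 * N)).
have del0 : 0 < del by rewrite lt_min bx0 divr_gt0// mulr_gt0.
pose Q := P - (1 + del%:C)%:P.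
have Q0 : Q.[0] = - del%:C by rewrite /Q hornerD hornerN hornerC P0 opprD addNKr.
have Q1 : Q^`().[0] = P^`().[0] by rewrite /Q derivB derivC subr0.
(* The root is [z = e s], so a modulus below [r s] gives [e] of modulus below [r]. *)
have [|z rz zeta] := @small_root _ (r * s%:C) Q eta0.
  rewrite Q0 Q1 normrN -/M ME normc_def/= expr0n/= addr0 sqrtr_sqr gtr0_norm//.
  apply: (@le_lt_trans _ _ (N * del)%:C).
    rewrite rmorphM/= rmorph_nat ler_wpM2r ?ler0c ?(ltW del0)// ler_nat.
    rewrite (leq_trans (size_polyD _ _))// geq_max leqnSn/= size_polyN.
    by rewrite (leq_trans (size_polyC_leq1 _)).
  rewrite ltcR; apply: (@le_lt_trans _ _ (complex.Re M / 2)).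
    rewrite (_ : complex.Re M / 2 = N * (complex.Re M / (2 * N))).
      by rewrite ler_wpM2l ?(ltW N0)// ge_min lexx orbT.
    by field; rewrite gt_eqF.
  by rewrite ltr_pdivrMr// mulr_natr mulr2n ltrDl.
have z0 : z != 0.
  apply: contraTneq rz => ->; rewrite /root Q0 oppr_eq0.
  by rewrite gt_eqF// ltcR.
exists (z / s%:C); apply: Hr.
  rewrite /= sub0r normrN normrM normfV (gtr0_norm sC0).
  by rewrite ltr_pdivrMr.
split; first by rewrite mulf_neq0// invr_eq0 gt_eqF.
exists (x * (1 + del)).
  rewrite /= in_itv/=; apply/andP; split.
    by rewrite (le_trans (ltW ax))// ler_peMr ?(ltW x0)// lerDl ltW.
  have : del <= (b - x) / x by rewrite ge_min lexx.
  by rewrite ler_pdivlMr// mulrDr mulr1 mulrC; lra.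
rewrite divfK ?gt_eqF// rmorphM rmorphD/= rmorph1; congr (_ * _).
by apply/eqP; rewrite -subr_eq0; move: rz; rewrite /root /Q hornerD hornerN hornerC.
Qed.

(** With [P = q X + 1] and [Y = x P(e s)], the quotient is the slope of [h] between [x] and [Y]
    times [(Y - x) / e = x s q(e s)], and [q(0) = P'(0)]. *)
Lemma cvg_horner_slope : derivable h x 1 ->
  (((h (complex.Re (x%:C * P.[e * s%:C])) - h x)%:C / e : R[i]^o))
    @[e --> within V (nbhs (0 : R[i]^o))] -->
  ((derive1 h x)%:C * (x%:C * s%:C * P^`().[0]) : R[i]^o).
Proof.
move=> dh; set G := within V _.
have FG : ProperFilter G := within_horner_real_proper.
have FG' : Filter G by exact: FG.
have GV : \forall e \near G, V e by exact: withinT.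
pose K : numFieldType := R[i].
have [q Pq] : exists q, P = q * 'X + 1.
  have : root (P - 1%:P) 0 by rewrite /root hornerD hornerN hornerC P0 subrr.
  by move=> /factor_theorem[q]; rewrite subr0 => /eqP; rewrite subr_eq => /eqP ->; exists q.
have PE z : P.[z] = q.[z] * z + 1 by rewrite {1}Pq -polyC1 hornerMXaddC.
have qE : q.[0] = P^`().[0].
  by rewrite Pq derivD derivM derivX mulr1 derivC addr0 hornerD hornerMX mulr0 add0r.
have cid : (e : R[i]^o) @[e --> G] --> (0 : R[i]^o).
  by apply: cvg_within.
have cu : (e * s%:C : R[i]^o) @[e --> G] --> (0 : R[i]^o).
  have := @cvgM K _ G FG' id (cst s%:C) 0 s%:C cid (@cvg_cst _ _ _ G FG').
  by rewrite mul0r.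
have cP : (P.[e * s%:C] : R[i]^o) @[e --> G] --> (1 : R[i]^o).
  by have := @cvg_horner K _ G P _ _ FG' cu; rewrite P0.
have cq : (q.[e * s%:C] : R[i]^o) @[e --> G] --> (P^`().[0] : R[i]^o).
  by have := @cvg_horner K _ G q _ _ FG' cu; rewrite qE.
have cY : complex.Re (x%:C * P.[e * s%:C]) @[e --> G] --> x.
  have := @cvgM K _ G FG' (cst x%:C) _ x%:C 1 (@cvg_cst _ _ _ G FG') cP.
  by rewrite mulr1 => /(cvg_complex_Re FG').
set Y := fun e => complex.Re _ in cY.
have YE e : V e -> (Y e - x)%:C = x%:C * s%:C * q.[e * s%:C] * e.
  move=> [_ [y _ xy]]; rewrite /Y xy rmorphB/= -xy PE; ring.
(* Since [q(e s)] tends to [P'(0) <> 0], [Y e] avoids [x] for [e] near [0], as the punctured limit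
   defining the derivative requires. *)
have Yx : \forall e \near G, Y e != x.
  have : \forall e \near G, q.[e * s%:C] != 0.
    exact: (@cvgr_neq0 K _ _ G FG' _ _ cq P1).
  apply: filterS2 GV => e Ve qe0; have [e0 _] := Ve.
  rewrite -subr_eq0 -(inj_eq (@complexI R)) YE// !mulf_neq0//.
    by rewrite gt_eqF// ltcR.
  by rewrite gt_eqF// ltcR.
have cYx : Y e @[e --> G] --> x^'.
  move=> U /= /cY; rewrite !near_simpl => H.
  by apply: filterS2 H Yx => e He ex; exact: He.
have cS := cvg_real_complex FG' (cvg_comp _ _ cYx (cvg_slope dh)).
have cq' : (x%:C * s%:C * q.[e * s%:C] : R[i]^o) @[e --> G] -->
    (x%:C * s%:C * P^`().[0] : R[i]^o).
  exact: (@cvgM K _ G FG' (cst (x%:C * s%:C)) _ _ _ (@cvg_cst _ _ _ G FG') cq).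
have := @cvgM K _ G FG' _ _ _ _ cS cq'.
apply: cvg_trans; apply: near_eq_cvg.
apply: filterS2 GV Yx => e Ve Yex; have [e0 _] := Ve.
have Yx0 : (Y e - x)%:C != 0 :> R[i] by rewrite (inj_eq (@complexI R)) subr_eq0.
rewrite /= -/(Y e) rmorphM/= fmorphV/=.
have -> : x%:C * s%:C * q.[e * s%:C] = (Y e - x)%:C / e by rewrite YE// mulfK.
by rewrite mulrA divfK.
Qed.

End horner_slope.

Lemma pochhammer0 (R : realType) (z : R[i]) : 0 < complex.Re z ->
  pochhammer z 0 = 1.
Proof. by move=> z0; rewrite /pochhammer addr0 divff// Gamma_neq0. Qed.

Lemma pochhammer_neq0 (R : realType) (z : R[i]) (s : R) :
  0 < complex.Re z -> 0 < s -> pochhammer z s != 0.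
Proof.
move=> z0 s0; rewrite /pochhammer mulf_neq0 ?invr_eq0 ?Gamma_neq0//.
by case: z z0 => x y /= x0; rewrite addr_gt0.
Qed.

Section truncated_V_derivative.
Context (R : realType) (i : nat) (gamma beta rho delta : R[i]) (p q alpha : R).
Hypotheses (hi : (1 <= i)%N).
Hypotheses (hgamma : 0 < complex.Re gamma) (hbeta : 0 < complex.Re beta).
Hypotheses (hrho : 0 < complex.Re rho) (hdelta : 0 < complex.Re delta).
Hypotheses (hp : 0 < p) (hq : 0 < q).

Let C := Vconst gamma beta rho delta p q.

Let Gamma_beta : Gamma beta != 0. Proof. exact: Gamma_neq0. Qed.

Let Gamma_gamma_beta : Gamma (gamma + beta) != 0.
Proof.
apply: Gamma_neq0; case: gamma hgamma => x y /= x0; case: beta hbeta => u v /= u0.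
by rewrite addr_gt0.
Qed.

Lemma Vconst_neq0 : C != 0.
Proof.
apply: mulf_neq0; last rewrite invr_eq0; apply: mulf_neq0;
  by [exact: Gamma_gamma_beta|exact: Gamma_beta|exact: pochhammer_neq0].
Qed.

(** [truncH] as a formal polynomial, so that the argument on roots applies to it. *)
Let P : {poly R[i]} := \poly_(k < i.+1)
  (Gamma beta * (pochhammer rho (q * k%:R) / pochhammer delta (p * k%:R) /
                 Gamma (gamma * k%:R + beta))).

Let truncHE (z : R[i]) : truncH i gamma beta rho delta p q z = P.[z].
Proof.
rewrite /P horner_poly /truncH big_mkord mulr_sumr; apply: eq_bigr => k _.
by rewrite -!mulrA [_^-1 * z ^+ k]mulrC.
Qed.

Let P0 : P.[0] = 1.
Proof.
rewrite horner_coef0 /P coef_poly !mulr0 add0r !pochhammer0// divr1 mul1r.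
by rewrite divff.
Qed.

Let P1 : P^`().[0] = C^-1.
Proof.
rewrite horner_coef0 coef_deriv /P coef_poly ltnS hi mulr1n !mulr1.
rewrite /C /Vconst; field.
by rewrite Gamma_beta Gamma_gamma_beta !pochhammer_neq0.
Qed.

Lemma VderivativeE (a b x : R) (h : R -> R) :
  x \in `]a, b[ -> 0 < x -> derivable h x 1 ->
  Vderivative i gamma beta rho delta p q alpha `[a, b]%classic h x =
  (derive1 h x)%:C * (x `^ (1 - alpha))%:C / C.
Proof.
move=> xab x0 dh; pose s := x `^ (- alpha).
have s0 : 0 < s by exact: powR_gt0.
have P1' : P^`().[0] != 0 by rewrite P1 invr_eq0 Vconst_neq0.
have cv := cvg_horner_slope P0 P1' xab x0 s0 dh.
have FG := within_horner_real_proper P0 P1' xab x0 s0.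
have xs : (x `^ (1 - alpha))%:C = x%:C * s%:C :> R[i].
  rewrite -rmorphM/= powRD; first by rewrite powRr1 ?(ltW x0).
  by rewrite (gt_eqF x0) implybT.
rewrite xs -P1 -mulrA.
have HE : truncH i gamma beta rho delta p q = horner P by apply/funext.
rewrite /Vderivative /Vdomain /= HE.
(* Properness of the filter makes the limit unique, so that [lim] returns the value found. *)
exact: (@cvg_lim (R[i]^o) (@norm_hausdorff _ _) _ _ FG _ _ cv).
Qed.

End truncated_V_derivative.

(** * Integration by parts *)

(** The V-fractional integral is over a closed interval, while [VderivativeE] covers interior points
    only; the endpoints have measure zero. *)
Lemma Rintegral_itv_cc_oo (R : realType) (a b : R) (u : R -> R) :
  let mu := @lebesgue_measure R in
  mu.-integrable `[a, b] (EFin \o u) ->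
  mu.-integrable `]a, b[ (EFin \o u) /\
  \int[mu]_(x in `[a, b]) u x = \int[mu]_(x in `]a, b[) u x.
Proof.
move=> mu iu.
have iu' : mu.-integrable `]a, b[ (EFin \o u).
  apply: (@integrableS _ _ _ mu `[a, b]%classic).
  - exact: measurable_itv.
  - exact: measurable_itv.
  - exact: subset_itv_oo_cc.
  - exact: iu.
split=> //; rewrite /Rintegral; congr fine.
by apply: integral_itv_bndoo; exact: measurable_int iu'.
Qed.

(** This reduces complex integrals to real ones. Integrability of [w] is read off from the real or
    the imaginary part of [F], according to which part of [c] is nonzero. *)
Lemma cintegral_real_factor (R : realType) (a b : R) (F : R -> R[i]) (w : R -> R)
    (c : R[i]) :
  let mu := @lebesgue_measure R in
  c != 0 -> cintegrable `[a, b]%classic F ->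
  (forall x, x \in `]a, b[ -> F x = (w x)%:C * c) ->
  mu.-integrable `]a, b[ (EFin \o w) /\
  cintegral `[a, b]%classic F = (\int[mu]_(x in `]a, b[) w x)%:C * c.
Proof.
move=> mu c0 [/Rintegral_itv_cc_oo[iRe eRe] /Rintegral_itv_cc_oo[iIm eIm]] Fw.
have mD : measurable (`]a, b[%classic : set (measurableTypeR R)) by exact: measurable_itv.
have FRe : {in `]a, b[%classic, (fun x => complex.Re (F x)) =1 (fun x => complex.Re c * w x)}.
  by move=> x; rewrite inE/= => /Fw ->; case: (c) => u v /=; rewrite mul0r subr0 mulrC.
have FIm : {in `]a, b[%classic, (fun x => complex.Im (F x)) =1 (fun x => complex.Im c * w x)}.
  by move=> x; rewrite inE/= => /Fw ->; case: (c) => u v /=; rewrite mul0r addr0 mulrC.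
have iw : mu.-integrable `]a, b[ (EFin \o w).
  have scale (r : R) (u : R -> R) : r != 0 -> mu.-integrable `]a, b[ (EFin \o u) ->
      {in `]a, b[%classic, u =1 (fun x => r * w x)} -> mu.-integrable `]a, b[ (EFin \o w).
    move=> r0 iu uw; have := integrable_EFinZ mD r^-1 iu.
    by apply: eq_integrable => // x xD /=; rewrite uw// mulKf.
  have [Re0|Re0] := eqVneq (complex.Re c) 0; last exact: scale Re0 iRe FRe.
  have Im0 : complex.Im c != 0.
    by apply: contraNneq c0 => Im0; rewrite eq_complex Re0 Im0/= eqxx.
  exact: scale Im0 iIm FIm.
have ERe : \int[mu]_(x in `[a, b]) complex.Re (F x) =
    complex.Re c * \int[mu]_(x in `]a, b[) w x.
  by rewrite eRe -(RintegralZl (complex.Re c) mD iw); exact: eq_Rintegral.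
have EIm : \int[mu]_(x in `[a, b]) complex.Im (F x) =
    complex.Im c * \int[mu]_(x in `]a, b[) w x.
  by rewrite eIm -(RintegralZl (complex.Im c) mD iw); exact: eq_Rintegral.
split=> //; rewrite /cintegral ERe EIm; case: (c) => u v /=.
by apply/eqP; rewrite eq_complex/=; apply/andP; split; apply/eqP; ring.
Qed.

(** The factor [Vconst] in front of the integral cancels the [1 / Vconst] produced by the
    V-derivative. *)
Lemma Vintegral_real (R : realType) (gamma beta rho delta : R[i])
    (p q alpha a b : R) (F : R -> R[i]) (w : R -> R) :
  let mu := @lebesgue_measure R in
  Vconst gamma beta rho delta p q != 0 -> Vintegrable alpha a b F ->
  (forall x, x \in `]a, b[ -> F x / (x `^ (1 - alpha))%:C =
    (w x)%:C / Vconst gamma beta rho delta p q) ->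
  mu.-integrable `]a, b[ (EFin \o w) /\
  Vintegral gamma beta rho delta p q alpha a b F =
    (\int[mu]_(x in `]a, b[) w x)%:C.
Proof.
move=> mu C0 iF /(cintegral_real_factor (invr_neq0 C0) iF)[iw E]; split=> //.
by rewrite /Vintegral E mulrCA divff// mulr1.
Qed.

(** [1 <= i] gives [truncH] a linear term: for [i = 0] it is constant, the V-derivative is [0] and
    the formula fails in general. The two integrability conditions give the integrals a meaning,
    since the derivative of a function differentiable on a segment need not be Lebesgue
    integrable. *)
Theorem theorem13 (R : realType) (i : nat) (gamma beta rho delta : R[i])
    (p q alpha a b : R) (f g : R -> R)
    (hi : (1 <= i)%N)
    (hgamma : 0 < complex.Re gamma) (hbeta : 0 < complex.Re beta)
    (hrho : 0 < complex.Re rho) (hdelta : 0 < complex.Re delta)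
    (hp : 0 < p) (hq : 0 < q) (hpq : q <= complex.Re gamma + p)
    (halpha0 : 0 < alpha) (halpha1 : alpha < 1)
    (ha : 0 <= a) (hab : a <= b)
    (hf : differentiable_on_segment a b f)
    (hg : differentiable_on_segment a b g)
    (hfVg : Vintegrable alpha a b (fun x =>
       (f x)%:C * Vderivative i gamma beta rho delta p q alpha `[a, b]%classic g x))
    (hgVf : Vintegrable alpha a b (fun x =>
       (g x)%:C * Vderivative i gamma beta rho delta p q alpha `[a, b]%classic f x)) :
  Vintegral gamma beta rho delta p q alpha a b (fun x =>
    (f x)%:C * Vderivative i gamma beta rho delta p q alpha `[a, b]%classic g x) =
  (f b * g b - f a * g a)%:C -
  Vintegral gamma beta rho delta p q alpha a b (fun x =>
    (g x)%:C * Vderivative i gamma beta rho delta p q alpha `[a, b]%classic f x).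
Proof.
(* For [a = b] the integrals are over a null set and the boundary term vanishes. *)
move: hab; rewrite le_eqVlt => /predU1P[ab|ab].
  rewrite -ab /Vintegral /cintegral set_itv1 !Rintegral_set1 subrr.
  by rewrite (_ : 0 +i* 0 = 0)// mulr0 subr0.
pose C := Vconst gamma beta rho delta p q.
have C0 : C != 0 by exact: Vconst_neq0.
have dF := differentiable_on_segment_derivable ab hf.
have dG := differentiable_on_segment_derivable ab hg.
(* The weight cancels the power [x^(1 - alpha)] in the V-derivative, leaving the ordinary [u v']
   over [C]; [0 <= a] makes interior points positive. *)
have integrand (u v : R -> R) (x : R) : derivable_oo_LRcontinuous v a b ->
    x \in `]a, b[ ->
    (u x)%:C * Vderivative i gamma beta rho delta p q alpha `[a, b]%classic v x /
      (x `^ (1 - alpha))%:C = (u x * derive1 v x)%:C * C^-1.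
  move=> [dv _ _] xab.
  have x0 : 0 < x by move: xab; rewrite in_itv => /andP[ax _]; exact: le_lt_trans ax.
  rewrite VderivativeE//; last exact: dv.
  have xa0 : (x `^ (1 - alpha))%:C != 0 :> R[i].
    by rewrite (inj_eq (@complexI R)) gt_eqF// powR_gt0.
  rewrite rmorphM/= -/C; set X := (x `^ _)%:C in xa0 *.
  by rewrite mulrA mulrAC mulrA mulfK.
have [ifg efg] := Vintegral_real C0 hfVg (fun x xab => integrand f g x dG xab).
have [igf egf] := Vintegral_real C0 hgVf (fun x xab => integrand g f x dF xab).
have mD : measurable (`]a, b[%classic : set (measurableTypeR R)) by exact: measurable_itv.
(* The fundamental theorem applies to [f g], whose derivative is a sum of two functions just shown
   to be integrable. *)
have parts : \int[lebesgue_measure]_(x in `]a, b[) (f x * derive1 g x + g x * derive1 f x) =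
    f b * g b - f a * g a.
  have [df fa fb] := dF; have [dg ga gb] := dG.
  apply: (@Rintegral_derive1 _ _ _ (fun x => f x * g x)).
  - exact: ab.
  - split; [|exact: cvgM|exact: cvgM].
    by move=> x xab; apply: derivableM; [exact: df|exact: dg].
  - exact: (integrable_EFinD mD ifg igf).
  - by move=> x xab; rewrite !derive1E deriveM//; [exact: df|exact: dg].
apply: (etrans efg); apply: esym; apply: (etrans (congr2 _ (erefl _) (congr1 _ egf))).
rewrite -parts (RintegralD mD ifg igf) rmorphD; exact: addrK.
Qed.
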